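(* Let $p>1$, let $p^*=\frac{p}{p-1}$ be the Hölder conjugate of $p$, and let $$(\beta,\lambda)\in\mathcal{D}_p=\left\{(\beta,\lambda)\in(0,\infty)^2:\ \beta\in\left(\tfrac{1}{p^*}\,,\,\tfrac{1}{p^*}+\min(1,\lambda)\right]\right\}.$$ Then there exists a universal optimal positive constant $K_{p,\beta,\lambda}$ that bounds from below the $(p,\beta,\lambda)$-Fisher--Rényi complexity of any density $\rho$, i.e. $$\forall\,\rho,\qquad C_{p,\beta,\lambda}[\rho]\ \ge\ K_{p,\beta,\lambda}.$$ The optimal bound is achieved when, up to a shift and a scaling factor, $$\rho_{p,\beta,\lambda}=u^{\vartheta}\qquad\text{with}\qquad\vartheta=\frac{p^*}{\beta p^*-1},$$ where $u$ is a solution of the differential equation $$-\frac{d}{dx}\left(\left|\frac{d}{dx}u\right|^{p-2}\frac{d}{dx}u\right)+\frac{\gamma}{\vartheta}\,\frac{u^{\lambda\vartheta-1}-u^{\vartheta-1}}{1-\lambda}=0,$$ with $\gamma$ determined a posteriori to impose that $u^{\vartheta}$ integrates to $1$. When $\lambda\to1$, the limit has to be taken, leading to $\frac{\gamma}{\vartheta}\,\frac{u^{\lambda\vartheta-1}-u^{\vartheta-1}}{1-\lambda}\to-\gamma\,u^{\vartheta-1}\log u$.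
   Context: For $\lambda>0$, the Rényi entropy power of a probability density $\rho$ on $\mathbb{R}$ is, provided the integral exists, $N_\lambda[\rho]=\exp(2H_\lambda[\rho])$ with $H_\lambda[\rho]=\frac{1}{1-\lambda}\log\int_{\mathbb{R}}[\rho(x)]^\lambda\,dx$; the limiting case $\lambda\to1$ gives the Shannon entropy power, with $H_1[\rho]=-\int_{\mathbb{R}}\rho(x)\log\rho(x)\,dx$. For $p\in(1,\infty)$ and $\beta>0$, the $(p,\beta)$-Fisher information of a continuously differentiable density $\rho$ is $$F_{p,\beta}[\rho]=\left(\int_{\mathbb{R}}\left|[\rho(x)]^{\beta-1}\,\frac{d}{dx}\log[\rho(x)]\right|^p\rho(x)\,dx\right)^{\frac{2}{p\beta}},$$ provided that this integral exists. When $\rho$ is strictly positive on a bounded support, the integration is to be understood over this support, but $\rho$ must be differentiable on the closure of this support. The $(p,\beta,\lambda)$-Fisher--Rényi complexity of $\rho$ is $C_{p,\beta,\lambda}[\rho]=\big(F_{p,\beta}[\rho]\,N_\lambda[\rho]\big)^\beta$, provided that the involved quantities exist; the inequality concerns densities for which it exists. It is invariant under replacing $\rho$ by $\frac1\sigma\rho\big(\frac{x-x_0}{\sigma}\big)$, $x_0\in\mathbb{R}$, $\sigma>0$; ''up to a shift and a scaling factor'' refers to this family. *)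

(* Defs.v *)
From HB Require Import structures.
From mathcomp Require Import all_boot all_order all_algebra.
From mathcomp Require Import all_classical all_reals all_analysis.

Set Implicit Arguments.
Unset Strict Implicit.
Unset Printing Implicit Defensive.

Import Order.TTheory GRing.Theory Num.Theory.
Import numFieldNormedType.Exports.

Local Open Scope classical_set_scope.
Local Open Scope ring_scope.

Section FisherRenyi.
Context {R : realType}.
Implicit Types (rho u : R -> R) (p beta lam gam : R).

Local Notation leb := (@lebesgue_measure R).

Definition posset rho : set R := [set x | 0 < rho x].

Definition is_density rho : Prop :=
  [/\ forall x, 0 <= rho x,
      measurable_fun [set: R] rho &
      (\int[leb]_x (rho x)%:E = 1)%E].

(* Continuous differentiability of a density that may vanish somewhere.
   Differentiability is two-sided and required at every real, in particular at
   the end points of a bounded support (so uniform densities, for which the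
   Fisher information below is 0, are excluded); continuity of the derivative
   is only required where rho is positive.  Every C^1 function satisfies this. *)
Definition regular rho : Prop :=
  (forall x : R, derivable rho x 1) /\
  (forall x : R, 0 < rho x -> {for x, continuous (derive1 rho)}).

(* Integrand of the entropy; it vanishes where rho does, as 0 `^ lam = 0 for
   lam <> 0. *)
Definition renyi_integrand lam rho (x : R) : R :=
  if lam == 1 then rho x * ln (rho x) else rho x `^ lam.

Definition renyi_entropy lam rho : R :=
  let I := Rintegral leb [set: R] (renyi_integrand lam rho) in
  if lam == 1 then - I else (1 - lam)^-1 * ln I.

Definition renyi_power lam rho : R := expR (2 * renyi_entropy lam rho).

Definition fisher_integrand p beta rho (x : R) : R :=
  `| rho x `^ (beta - 1) * derive1 (fun y => ln (rho y)) x | `^ p * rho x.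

Definition fisher p beta rho : R :=
  (Rintegral leb (posset rho) (fisher_integrand p beta rho))
    `^ (2 / (p * beta)).

Definition complexity p beta lam rho : R :=
  (fisher p beta rho * renyi_power lam rho) `^ beta.

Definition complexity_exists p beta lam rho : Prop :=
  leb.-integrable (posset rho) (EFin \o fisher_integrand p beta rho) /\
  leb.-integrable [set: R] (EFin \o renyi_integrand lam rho).

Definition admissible p beta lam rho : Prop :=
  [/\ is_density rho, regular rho & complexity_exists p beta lam rho].

Definition conj_exp p : R := p / (p - 1).

Definition Dp p : set (R * R) :=
  [set bl | [/\ 0 < bl.1, 0 < bl.2, (conj_exp p)^-1 < bl.1 &
                bl.1 <= (conj_exp p)^-1 + Num.min 1 bl.2]].

Definition vartheta p beta : R := conj_exp p / (beta * conj_exp p - 1).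

Definition shift_scale (x0 sigma : R) rho : R -> R :=
  fun x => sigma^-1 * rho ((x - x0) / sigma).

(* |u'|^(p-2) u'; at a zero of u' the value is 0, whatever p > 1. *)
Definition pflux p u (x : R) : R := `| derive1 u x | `^ (p - 2) * derive1 u x.

Definition reaction_neq1 theta gam lam (v : R) : R :=
  gam / theta * ((v `^ (lam * theta - 1) - v `^ (theta - 1)) / (1 - lam)).

Definition reaction_eq1 theta gam (v : R) : R :=
  - gam * v `^ (theta - 1) * ln v.

Definition reaction theta gam lam (v : R) : R :=
  if lam == 1 then reaction_eq1 theta gam v else reaction_neq1 theta gam lam v.

(* Nonnegative solutions of the differential equation on the real line.  A
   solution may have a bounded support, in which case it is extended by 0; the
   equation is then imposed on the set where u > 0 (at a zero of u the reaction
   term may involve 0^0).  Global C^1 regularity forces u' = 0 at the end points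
   of the support, and the support is connected: without the latter, a sum of
   disjoint translates of a compactly supported solution would qualify. *)
Definition is_solution p beta lam gam u : Prop :=
  [/\ forall x, 0 <= u x,
      forall x : R, derivable u x 1,
      continuous (derive1 u),
      is_interval (posset u) &
      forall x : R, 0 < u x ->
        derivable (pflux p u) x 1 /\
        - derive1 (pflux p u) x + reaction (vartheta p beta) gam lam (u x) = 0].

End FisherRenyi.

(* Main.v *)
Require Import Defs.
From HB Require Import structures.
From mathcomp Require Import all_boot all_order all_algebra.
From mathcomp Require Import ring lra.
From mathcomp Require Import all_classical all_reals all_analysis.
From mathcomp Require Import measurable_realfun.

Set Implicit Arguments.
Unset Strict Implicit.
Unset Printing Implicit Defensive.

Import Order.TTheory GRing.Theory Num.Theory.
Import numFieldNormedType.Exports.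

Local Open Scope classical_set_scope.
Local Open Scope ring_scope.

(* Write q for the conjugate exponent, ell y = (y^(lam-1) - 1) / (1 - lam) (or
   - ln y), W for its antiderivative with W 0 = 0, positive on ]0, ymax[, and
   k = q / theta.

   Lower bound: the Fisher integrand is (|rho'| rho^(1/theta - 1))^p.  For
   mu = sup rho / ymax, Young's inequality for this quantity and
   W(rho / mu)^(1/q), integrated from a near-maximum of rho down to level 0 on
   either side, bounds the product of the Fisher information and of the q-norm
   of W(rho / mu)^(1/q) from below by 2 theta mu^(1/theta) J, J being the
   integral of W(v^theta)^(1/q).  As the integral of W(rho / mu) is
   exp(H) W(y) with y = exp(- H) / mu, the unknown mu disappears in the estimate
   y^k W(y) <= max.

   Equality: it holds for rho = mu u^theta as soon as u is a profile, i.e. rises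
   then falls with |u'|^p = kap^p W(u^theta).  The energy of a solution of the
   differential equation is constant, and 0 because u and u' are simultaneously
   small somewhere; uniqueness of the critical point then makes u a profile.
   Conversely a profile is obtained by inverting an antiderivative, and kap is
   adjusted to the mass. *)

(** * Calculus on the real line *)

(** [W] is read off from the differential equation: multiplied by [u'] and integrated, the equation
    makes [|u'|^p] proportional to [W(u^theta)]. For [rho = mu u^theta] the powers of [u] in
    [|rho'| rho^(1/theta - 1)] cancel, so this first integral is exactly the equality case of
    Young's inequality with the second factor [W(rho / mu)^(1/q)]; this dictates the weight used for
    arbitrary densities. In the constant, [2] counts the two runs, [theta J] comes from the
    substitution [r = mu v^theta], and the square from the power [2 / p] in which the Fisher
    integral enters the complexity. The first-order equation is degenerate: [W(v^theta)] vanishes at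
    the maximal value of [u], and its power [1/p] is not Lipschitz there, so plateaus at the top are
    compatible with it; only the second-order equation excludes them. The top is also where
    derivatives have to be recovered by a limit or by a change of parameter. Bounded and unbounded
    supports are treated together: a profile is only asked to tend to 0. *)

Section Calculus.
Context {R : realType}.
Implicit Types (f g h F : R -> R) (a b c x y z : R).

Lemma continuous_epsP f a : {for a, continuous f} <->
  forall e : R, 0 < e -> exists2 d : R, 0 < d & forall x, `|x - a| < d -> `|f x - f a| < e.
Proof.
split=> [/cvgrPdist_lt fa e e0|fa].
  have /nbhs_ballP[d /= d0 H] := fa e e0; exists d => // x xa.
  by rewrite distrC; apply: H; rewrite /ball/= distrC.
apply/cvgrPdist_lt => e e0; have [d d0 H] := fa e e0.
apply/nbhs_ballP; exists d => //= x; rewrite /ball/= => xa.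
by rewrite distrC; apply: H; rewrite distrC.
Qed.

Lemma near_epsP (P : R -> Prop) a : (\forall x \near a, P x) <->
  exists2 d : R, 0 < d & forall x, `|x - a| < d -> P x.
Proof.
split=> [/nbhs_ballP[d /= d0 H]|[d d0 H]].
  by exists d => // x xa; apply: H; rewrite /ball/= distrC.
by apply/nbhs_ballP; exists d => //= x; rewrite /ball/= => xa; apply: H; rewrite distrC.
Qed.

Lemma is_deriveDfun f g x a b : is_derive x 1 f a -> is_derive x 1 g b ->
  is_derive x 1 (fun y => f y + g y) (a + b).
Proof. by move=> fa gb; exact: is_deriveD. Qed.

Lemma is_deriveMfun f g x a b : is_derive x 1 f a -> is_derive x 1 g b ->
  is_derive x 1 (fun y => f y * g y) (f x * b + a * g x).
Proof.
move=> fa gb; have := is_deriveM fa gb.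
by move=> /is_derive_eq; apply; rewrite /GRing.scale/= [a * _]mulrC.
Qed.

Lemma is_deriveZfun f k x a : is_derive x 1 f a ->
  is_derive x 1 (fun y => k * f y) (k * a).
Proof.
move=> fa; have := is_deriveMfun (is_derive_cst k x 1) fa.
by move=> /is_derive_eq; apply; rewrite mul0r addr0.
Qed.

Lemma is_deriveNfun f x a : is_derive x 1 f a -> is_derive x 1 (fun y => - f y) (- a).
Proof. by move=> fa; exact: is_deriveN. Qed.

Lemma is_derive_near f g x a : (\forall y \near x, f y = g y) ->
  is_derive x 1 f a -> is_derive x 1 g a.
Proof. exact: near_eq_is_derive. Qed.

Lemma is_derive_ball f g x a d : 0 < d ->
  (forall y, `|y - x| < d -> f y = g y) ->
  is_derive x 1 f a -> is_derive x 1 g a.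
Proof.
move=> d0 fg; apply: near_eq_is_derive.
by apply/near_epsP; exists d.
Qed.

Lemma is_derive_idfun x : is_derive x 1 (fun y : R => y) 1.
Proof. exact: is_derive_id. Qed.

Lemma is_derive_cstfun c x : is_derive x 1 (fun=> c) 0.
Proof. exact: is_derive_cst. Qed.

Lemma is_derive_oppfun x : is_derive x 1 (fun y : R => - y) (-1).
Proof. exact: is_deriveNfun (is_derive_idfun x). Qed.

Lemma is_derive_compfun f g x a b : is_derive (g x) 1 f a -> is_derive x 1 g b ->
  is_derive x 1 (fun y => f (g y)) (a * b).
Proof. by move=> fa gb; exact: is_derive1_comp. Qed.

Lemma is_derive_derive1 f x a : is_derive x 1 f a -> derive1 f x = a.
Proof. by move=> fa; rewrite derive1E derive_val. Qed.

Lemma derivable_is_derive f x : derivable f x 1 -> is_derive x 1 f (derive1 f x).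
Proof. by move=> df; rewrite derive1E; exact/derivableP. Qed.

Lemma is_derive_continuous f x a : is_derive x 1 f a -> {for x, continuous f}.
Proof. by move=> [df _]; apply/differentiable_continuous/derivable1_diffP. Qed.

Lemma continuous_itvcc f a b : (forall x, a <= x <= b -> {for x, continuous f}) ->
  {within `[a, b], continuous f}.
Proof.
move=> fc; apply: continuous_in_subspaceT => x /[!inE]/= /[!in_itv]/= xab.
exact: fc.
Qed.

Lemma mean_value f (df : R -> R) a b : a < b ->
  (forall x, a < x < b -> is_derive x 1 f (df x)) ->
  (forall x, a <= x <= b -> {for x, continuous f}) ->
  exists2 c, a < c < b & f b - f a = df c * (b - a).
Proof.
move=> ab fd fc.
have fd' x : x \in `]a, b[%R -> is_derive x 1 f (df x).
  by rewrite in_itv/=; exact: fd.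
have [c cab ->] := MVT ab fd' (continuous_itvcc fc).
by exists c => //; move: cab; rewrite in_itv/=.
Qed.

(** By the mean value theorem, each difference quotient at [a] is a value of [g] at a point closer
    to [a]. This serves at the exceptional points of a profile: for the flux at the top, and for the
    profile itself at an end of its support. *)
Lemma is_derive_extend f g a :
  (\forall x \near a, x != a -> is_derive x 1 f (g x)) ->
  {for a, continuous f} -> {for a, continuous g} -> is_derive a 1 f (g a).
Proof.
move=> /near_epsP[r r0 fg] fa ga; apply/is_derive1_caratheodory.
exists (fun z => if z == a then g a else (f z - f a) / (z - a)); split.
- move=> z; case: eqP => [->|/eqP]; first by rewrite !subrr mulr0.
  by rewrite -subr_eq0 => za; rewrite divfK.
- apply/continuous_epsP => e e0; rewrite eqxx.
  have [d d0 H] := (continuous_epsP g a).1 ga e e0.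
  exists (Num.min r d); first by rewrite lt_min r0.
  move=> x; rewrite lt_min => /andP[xr xd].
  case: eqVneq => [_|xa]; first by rewrite subrr normr0.
  have fc y : `|y - a| < r -> {for y, continuous f}.
    by have [->//|ya yr] := eqVneq y a; exact: is_derive_continuous (fg _ yr ya).
  have key u v : u < v -> (u == a) || (v == a) -> `|u - a| < Num.min r d ->
     `|v - a| < Num.min r d ->
     exists2 c, `|c - a| < d & f v - f u = g c * (v - u).
    move=> uv; rewrite !lt_min => uva /andP[ur ud] /andP[vr vd].
    have btw (s : R) y : u <= y <= v -> `|u - a| < s -> `|v - a| < s -> `|y - a| < s.
      by rewrite !ltr_norml => /andP[? ?] /andP[? ?] /andP[? ?]; lra.
    have [||c /andP[uc cv] E] := @mean_value f g u v uv.
    + move=> y /andP[uy yv]; apply: fg; first by apply: btw ur vr; rewrite !ltW.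
      by case/orP: uva => /eqP <-; [rewrite gt_eqF|rewrite lt_eqF].
    + by move=> y yuv; apply: fc; exact: btw ur vr.
    by exists c => //; apply: btw ud vd; rewrite !ltW.
  have xrd : `|x - a| < Num.min r d by rewrite lt_min xr.
  have ard : `|a - a| < Num.min r d by rewrite subrr normr0 lt_min r0.
  case: (ltrgtP x a) xa => // [xa|xa] _.
  + have [|c cd E] := key _ _ xa _ xrd ard; first by rewrite eqxx orbT.
    suff -> : (f x - f a) / (x - a) = g c by exact: H.
    rewrite -[f x - _]opprB E -[x - a]opprB invrN mulrNN mulfK//.
    by rewrite subr_eq0 gt_eqF.
  + have [|c cd E] := key _ _ xa _ ard xrd; first by rewrite eqxx.
    by rewrite E mulfK ?H// subr_eq0 gt_eqF.
- by rewrite eqxx.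
Qed.

Lemma continuousDfun f g x : {for x, continuous f} -> {for x, continuous g} ->
  {for x, continuous (fun y => f y + g y)}.
Proof. by move=> fc gc; exact: (continuousD fc gc). Qed.

Lemma continuousMfun f g x : {for x, continuous f} -> {for x, continuous g} ->
  {for x, continuous (fun y => f y * g y)}.
Proof. by move=> fc gc; exact: (continuousM fc gc). Qed.

Lemma continuousZfun f k x : {for x, continuous f} ->
  {for x, continuous (fun y => k * f y)}.
Proof. by move=> fc; apply: continuousMfun fc; exact: cst_continuous. Qed.

Lemma continuousNfun f x : {for x, continuous f} -> {for x, continuous (fun y => - f y)}.
Proof. by move=> fc; exact: (continuousN fc). Qed.

Lemma continuous_compfun f g x : {for x, continuous g} -> {for g x, continuous f} ->
  {for x, continuous (fun y => f (g y))}.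
Proof. by move=> gc fc; exact: (continuous_comp gc fc). Qed.

Lemma continuous_max0 f x : {for x, continuous f} ->
  {for x, continuous (fun y => Num.max (f y) 0)}.
Proof.
move=> /continuous_epsP fc; apply/continuous_epsP => e /fc[d d0 H].
exists d => // y /H; rewrite !ltr_norml => /andP[? ?].
by rewrite !maxEle; case: ifPn; case: ifPn; rewrite -?ltNge => ? ?; lra.
Qed.

(** A power of a negative base is a default value, so the truncation at 0 is what makes the function
    continuous across 0. All later functions of [u] or [rho] are truncated for the same reason. *)
Lemma powR_max0_continuous r : 0 < r -> continuous (fun x : R => (Num.max x 0) `^ r).
Proof.
move=> r0 x; have [x0|x0|->] := ltgtP x 0.
- apply/continuous_epsP => e e0; exists (- x); first by rewrite oppr_gt0.
  move=> y; rewrite ltr_norml => /andP[_ yx].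
  by rewrite !(max_idPr _) ?subrr ?normr0//; lra.
- have : is_derive x 1 (fun x : R => (Num.max x 0) `^ r) (r * x `^ (r - 1)).
    apply: (is_derive_near _ (is_derive1_powR r x0)).
    apply/near_epsP; exists x => // y; rewrite ltr_norml => /andP[yx _].
    by rewrite (max_idPl _)//; lra.
  exact: is_derive_continuous.
- apply/continuous_epsP => e e0; exists (e `^ r^-1); first exact: powR_gt0.
  move=> y; rewrite subr0 maxxx powR0 ?gt_eqF// subr0 => ye.
  rewrite ger0_norm ?powR_ge0//.
  have -> : e = (e `^ r^-1) `^ r by rewrite -powRrM mulVf ?gt_eqF// powRr1// ltW.
  apply: gt0_ltr_powR; rewrite ?nnegrE ?powR_ge0 ?le_max ?lexx ?orbT//.
  by rewrite gt_max powR_gt0// andbT (le_lt_trans (ler_norm _)).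
Qed.

Lemma powR_norm_continuous r : 0 < r -> continuous (fun x : R => `|x| `^ r).
Proof.
move=> r0 x.
have -> : (fun x : R => `|x| `^ r) = (fun x => (Num.max x 0) `^ r) \o Num.norm.
  by apply/funext => y /=; rewrite (max_idPl _).
apply: continuous_comp; [exact: norm_continuous|exact: powR_max0_continuous].
Qed.

Lemma is_derive_powR_norm r x : 1 < r ->
  is_derive x 1 (fun x : R => `|x| `^ r) (r * (`|x| `^ (r - 2) * x)).
Proof.
move=> r1; have [x0|x0|->] := ltgtP x 0.
- have H : is_derive x 1 (fun y : R => (- y) `^ r) (r * (- x) `^ (r - 1) * -1).
    have x0' : 0 < - x by rewrite oppr_gt0.
    exact: (is_derive_compfun (is_derive1_powR r x0') (is_derive_oppfun x)).
  apply: (@is_derive_near (fun y : R => (- y) `^ r)).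
    apply/near_epsP; exists (- x); first by rewrite oppr_gt0.
    move=> y; rewrite ltr_norml => /andP[_ yx].
    by rewrite ltr0_norm//; lra.
  apply: is_derive_eq H _; rewrite ltr0_norm// -mulrA; congr (_ * _).
  have -> : r - 1 = r - 2 + 1 by lra.
  have xn : - x != 0 by rewrite oppr_eq0 lt_eqF.
  by rewrite powRD ?xn ?implybT// powRr1 ?oppr_ge0 ?ltW//; ring.
- apply: (@is_derive_near (fun y : R => y `^ r)).
    apply/near_epsP; exists x => // y; rewrite ltr_norml => /andP[yx _].
    by rewrite gtr0_norm//; lra.
  apply: is_derive_eq (is_derive1_powR r x0) _; rewrite gtr0_norm//; congr (_ * _).
  have -> : r - 1 = r - 2 + 1 by lra.
  have xn : x != 0 by rewrite gt_eqF.
  by rewrite powRD ?xn ?implybT// powRr1 ?ltW.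
(* At 0 the difference quotient is [sg z * |z|^(r - 1)], which tends to 0 because [r > 1]. *)
- rewrite !mulr0; apply/is_derive1_caratheodory.
  exists (fun z => Num.sg z * `|z| `^ (r - 1)); split => [z||].
  + rewrite normr0 powR0 ?subr0; last lra.
    by rewrite mulrAC -normrEsg mulr_powRB1//; lra.
  + apply/continuous_epsP => e e0.
    have := @powR_norm_continuous (r - 1) _ 0; rewrite subr_gt0 => /(_ r1).
    move=> /continuous_epsP /(_ e e0)[d d0 H]; exists d => // z zd.
    have := H z zd; rewrite normr0 sgr0 mul0r powR0 ?subr0; last lra.
    apply: le_lt_trans; rewrite normrM ler_piMl//.
    by rewrite normr_sg; case: (_ != 0); rewrite /= ?mulr1n// lexx.
  + by rewrite sgr0 mul0r.
Qed.

Lemma integrable_itvcc f a b : (forall x, a <= x <= b -> {for x, continuous f}) ->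
  (@lebesgue_measure R).-integrable `[a, b] (EFin \o f).
Proof.
move=> fc; apply: continuous_compact_integrable; first exact: segment_compact.
exact: continuous_itvcc.
Qed.

(* The integral from -1 of a function vanishing on the negative half-line is a
   primitive on the whole line. *)
Lemma antiderivative_half h : continuous h -> (forall x, x <= 0 -> h x = 0) ->
  exists F, forall x, is_derive x 1 F (h x).
Proof.
move=> hc h0.
exists (fun x => (\int[lebesgue_measure]_(t in [set` `[(-1 : R), x]]) (h t))%R) => x.
have [x1|x1] := leP x (- 2^-1).
  rewrite h0; last lra.
  apply: (is_derive_near _ (is_derive_cstfun 0 x)).
  apply/near_epsP; exists (2^-1); first lra.
  move=> y; rewrite ltr_norml => /andP[_ yx].
  rewrite (@eq_Rintegral _ _ _ lebesgue_measure `[(-1 : R), y] (cst 0)).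
    by rewrite Rintegral_cst// mul0r.
  by move=> t; rewrite inE/= in_itv/= => /andP[t1 ty]; rewrite h0//; lra.
have [||||dF FE] := @continuous_FTC1_closed R h (-1) x (x + 1).
- by rewrite ltrDl.
- by apply: integrable_itvcc => y _; exact: hc.
- lra.
- exact: hc.
have F'E : 'D_1 (fun x : R => (\int[lebesgue_measure]_(t in [set` `[(-1 : R), x]]) (h t))%R) x = h x.
  by rewrite -derive1E.
exact (DeriveDef dF F'E).
Qed.

(** Once [f 0] is subtracted, the parts of [f] on the two half-lines extend continuously by 0.
    [antiderivative_half] applies to each, the negative one after a reflection. *)
Lemma antiderivative f : continuous f -> exists F, forall x, is_derive x 1 F (f x).
Proof.
move=> fc.
have cm (s : R) : continuous (fun x => f (s * Num.max x 0) - f 0).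
  move=> x; apply: continuousB; last exact: cst_continuous.
  apply: (@continuous_comp _ _ _ (fun x => s * Num.max x 0) f); last exact: fc.
  apply: continuousM; first exact: cst_continuous.
  by apply: continuous_max0; exact: id.
have [|A dA] := antiderivative_half (cm 1).
  by move=> x x0; rewrite (max_idPr _)// mulr0 subrr.
have [|B dB] := antiderivative_half (cm (-1)).
  by move=> x x0; rewrite (max_idPr _)// mulr0 subrr.
exists (fun x => A x + - B (- x) + f 0 * x) => x.
have H := is_deriveDfun (is_deriveDfun (dA x) (is_deriveNfun
  (is_derive_compfun (dB (- x)) (is_derive_oppfun x))))
  (is_deriveZfun (f 0) (is_derive_idfun x)).
apply: is_derive_eq H _.
rewrite mul1r mulN1r; have [x0|x0] := leP 0 x.
  by rewrite (max_idPr _) ?oppr_le0// oppr0; lra.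
by rewrite (max_idPl _) ?oppr_ge0 ?ltW// opprK; lra.
Qed.

End Calculus.

(** * The entropy potential *)

Section Potential.
Context {R : realType}.
Variable lam : R.
Hypothesis lam0 : 0 < lam.

(* [y * ell y] integrates to an affine function of the Rényi integral, and the
   reaction term is a multiple of [v `^ (theta - 1) * ell (v `^ theta)]. *)
Definition ell (y : R) : R :=
  if lam == 1 then - ln y else (y `^ (lam - 1) - 1) / (1 - lam).

(* The antiderivative of [ell] that vanishes at 0. *)
Definition pot (y : R) : R := y * (1 + ell y) / lam.

(* The inverse of [ell], needed at the levels [a] in [-1, 0] only; for such [a]
   the base of the power is positive whatever [lam]. *)
Definition level (a : R) : R :=
  if lam == 1 then expR (- a) else (1 + (1 - lam) * a) `^ (lam - 1)^-1.

(** This form also holds for [lam = 1], which spares [is_derive_pot] the case split. *)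
Lemma powR_ell (y : R) : 0 < y -> y `^ (lam - 1) = 1 + (1 - lam) * ell y.
Proof.
move=> y0; rewrite /ell; case: eqVneq => [->|l1].
  by rewrite subrr powRr0 mul0r addr0.
by rewrite mulrC divfK ?subr_eq0 1?eq_sym//; lra.
Qed.

Lemma is_derive_ell (y : R) : 0 < y -> is_derive y 1 ell (- y `^ (lam - 2)).
Proof.
move=> y0; have [l1|l1] := eqVneq lam 1.
  have -> : ell = (fun y => - ln y) by apply/funext => z; rewrite /ell l1 eqxx.
  apply: is_derive_eq (is_deriveNfun (is_derive1_ln y0)) _.
  have -> : lam - 2 = -1 by rewrite l1; lra.
  by rewrite powR_inv1 ?ltW.
have -> : ell = (fun y => (1 - lam)^-1 * (y `^ (lam - 1) + - 1)).
  by apply/funext => z; rewrite /ell (negPf l1) mulrC.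
have H := is_deriveZfun (1 - lam)^-1
  (is_deriveDfun (is_derive1_powR (lam - 1) y0) (is_derive_cstfun (-1) y)).
apply: is_derive_eq H _.
have -> : lam - 1 - 1 = lam - 2 by lra.
by rewrite addr0; field; rewrite subr_eq0 eq_sym.
Qed.

Lemma ell_decr (y z : R) : 0 < y -> y < z -> ell z < ell y.
Proof.
move=> y0 yz; have [||c /andP[yc cz] E] :=
  @mean_value _ ell (fun y => - y `^ (lam - 2)) y z yz.
- by move=> x /andP[yx _]; apply: is_derive_ell; exact: lt_trans yx.
- move=> x /andP[yx _]; apply: is_derive_continuous (is_derive_ell _).
  exact: lt_le_trans yx.
rewrite -subr_lt0 E mulNr oppr_lt0 mulr_gt0 ?subr_gt0//.
by rewrite powR_gt0// (lt_trans y0).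
Qed.

Lemma level_gt0 (a : R) : -1 <= a <= 0 -> 0 < level a.
Proof.
move=> /andP[a1 a0]; rewrite /level; case: eqVneq => l1; first exact: expR_gt0.
apply: powR_gt0; have [l|l] := leP lam 1; last first.
  have : 0 <= (lam - 1) * - a by apply: mulr_ge0; lra.
  by lra.
have : 0 <= (1 - lam) * (a + 1) by apply: mulr_ge0; lra.
by move=> H; have := lam0; lra.
Qed.

Lemma ell_level (a : R) : -1 <= a <= 0 -> ell (level a) = a.
Proof.
move=> Ha; have := level_gt0 Ha; rewrite /level /ell; case: eqVneq => l1.
  by rewrite expRK opprK.
have l1' : lam - 1 != 0 by rewrite subr_eq0.
move=> L; rewrite -powRrM mulVf// powRr1.
  by rewrite addrAC subrr add0r mulrAC mulfV ?mul1r// subr_eq0 eq_sym.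
rewrite leNgt; apply/negP => neg; case/andP: Ha => a1 a0.
have [l|l] := leP lam 1; last first.
  have : 0 <= (lam - 1) * - a by apply: mulr_ge0; lra.
  by lra.
have : 0 <= (1 - lam) * (a + 1) by apply: mulr_ge0; lra.
by move=> H; have := lam0; lra.
Qed.

Lemma is_derive_pot (y : R) : 0 < y -> is_derive y 1 pot (ell y).
Proof.
move=> y0.
have -> : pot = (fun y => lam^-1 * (y * (1 + ell y))).
  by apply/funext => z; rewrite /pot mulrC.
have H := is_deriveZfun lam^-1 (is_deriveMfun (is_derive_idfun y)
  (is_deriveDfun (is_derive_cstfun 1 y) (is_derive_ell y0))).
apply: is_derive_eq H _.
have yE : y * y `^ (lam - 2) = y `^ (lam - 1).
  have -> : lam - 1 = 1 + (lam - 2) by lra.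
  by rewrite [RHS]powRD ?(gt_eqF y0) ?implybT// powRr1// ltW.
by rewrite add0r mulrN yE powR_ell//; field; rewrite gt_eqF.
Qed.

Lemma pot0 : pot 0 = 0.
Proof. by rewrite /pot mul0r mul0r. Qed.

Lemma pot_neq1E (y : R) : lam != 1 -> 0 <= y ->
  pot y = (1 - lam)^-1 * (lam^-1 * y `^ lam - y).
Proof.
move=> l1; rewrite le_eqVlt => /predU1P[<-|y0].
  by rewrite pot0 powR0 ?gt_eqF// !mulr0 subrr mulr0.
have <- : y * y `^ (lam - 1) = y `^ lam by rewrite mulr_powRB1 ?ltW.
rewrite powR_ell// /pot; field.
by rewrite subr_eq0 [1 == _]eq_sym l1 gt_eqF.
Qed.

Lemma pot_max0_continuous (y : R) : {for y, continuous (fun y : R => pot (Num.max y 0))}.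
Proof.
have [l1|l1] := eqVneq lam 1; last first.
  have -> : (fun y : R => pot (Num.max y 0)) =
      (fun y : R => (1 - lam)^-1 * (lam^-1 * (Num.max y 0) `^ lam - Num.max y 0)).
    by apply/funext => z; rewrite pot_neq1E// le_max lexx orbT.
  apply: continuousZfun; apply: continuousDfun.
    by apply: continuousZfun; exact: powR_max0_continuous.
  by apply: continuousNfun; apply: continuous_max0; exact: id.
have [y0|y0|->] := ltgtP y 0.
- apply/continuous_epsP => e e0; exists (- y); first by rewrite oppr_gt0.
  move=> z; rewrite ltr_norml => /andP[_ yz].
  by rewrite !(max_idPr _) ?subrr ?normr0//; lra.
- apply: (@is_derive_continuous _ _ _ (ell y)).
  apply: (is_derive_near _ (is_derive_pot y0)); apply/near_epsP; exists y => // z.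
  by rewrite ltr_norml => /andP[yz _]; rewrite (max_idPl _)//; lra.
(* Only [lam = 1] at 0 is left. As [ln x < x] at [x = z^(-1/2)], [- ln z = 2 ln x] is at most
   [2 z^(-1/2)], hence [- z ln z <= 2 z^(1/2)]. *)
have bound (z : R) : 0 <= z -> z < 1 -> `|pot z| <= z + 2 * z `^ 2^-1.
  rewrite le_eqVlt => /predU1P[<- _|z0 z1].
    by rewrite pot0 normr0 add0r mulr_ge0 ?powR_ge0.
  have lz : ln z <= 0 by apply: ln_le0; rewrite ltW.
  rewrite /pot /ell l1 eqxx divr1 ger0_norm; last by rewrite mulr_ge0 ?ltW//; lra.
  rewrite mulrDr mulr1 lerD2l.
  have := ln_sublinear (powR_gt0 (- 2^-1) z0); rewrite ln_powR => lzz.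
  have -> : z `^ 2^-1 = z * z `^ (- 2^-1).
    rewrite -[X in X * _]powRr1 ?ltW// -powRD ?(gt_eqF z0) ?implybT//.
    by congr (_ `^ _); lra.
  by rewrite mulrCA ler_wpM2l ?ltW//; lra.
have bc : {for 0, continuous (fun z : R => Num.max z 0 + 2 * (Num.max z 0) `^ 2^-1)}.
  apply: continuousDfun; first by apply: continuous_max0; exact: id.
  by apply: continuousZfun; apply: powR_max0_continuous; rewrite invr_gt0.
apply/continuous_epsP => e e0.
have [d d0 H] := (continuous_epsP _ _).1 bc e e0.
exists (Num.min d 1); first by rewrite lt_min d0 ltr01.
move=> z; rewrite lt_min => /andP[zd z1].
have := H _ zd; rewrite !maxxx powR0 ?invr_eq0// pot0 mulr0 addr0 !subr0.
apply: le_lt_trans; apply: le_trans (ler_norm _); apply: bound.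
  by rewrite le_max lexx orbT.
by rewrite gt_max ltr01 andbT; move: z1; rewrite subr0 => /ltr_normlW.
Qed.

(** The only positive zero of [pot], since [pot y] is proportional to [y * (1 + ell y)]. *)
Definition ymax := level (-1).

Lemma ymax_gt0 : 0 < ymax.
Proof. by apply: level_gt0; lra. Qed.

Lemma ell_ymax : ell ymax = -1.
Proof. by apply: ell_level; lra. Qed.

Lemma pot_gt0 (y : R) : 0 < y -> y < ymax -> 0 < pot y.
Proof.
move=> y0 ym; have := ell_decr y0 ym; rewrite ell_ymax => l.
by rewrite /pot divr_gt0// mulr_gt0//; lra.
Qed.

Lemma pot_ymax : pot ymax = 0.
Proof. by rewrite /pot ell_ymax subrr mulr0 mul0r. Qed.

Section Peak.
Variable k : R.
Hypothesis k0 : 0 < k.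

(** The critical point of [y^k * pot y], whose derivative is [y^k * ((lam + k) * ell y + k) / lam].
    In [profile_complexity] the number [exp(- H) / mu] of a profile turns out to be this point. *)
Definition ypeak := level (- (k / (lam + k))).

Let peak_range : -1 <= - (k / (lam + k)) <= 0.
Proof.
have lk : 0 < lam + k by rewrite addr_gt0.
rewrite lerN2 oppr_le0 divr_ge0 ?(ltW k0) ?(ltW lk)// andbT ler_pdivrMr// mul1r.
by rewrite lerDr ltW.
Qed.

Lemma ypeak_gt0 : 0 < ypeak. Proof. exact: level_gt0 peak_range. Qed.

Lemma ell_ypeak : ell ypeak = - (k / (lam + k)).
Proof. exact: ell_level peak_range. Qed.

Definition peak := ypeak `^ k * pot ypeak.

Lemma peak_gt0 : 0 < peak.
Proof.
have lk : 0 < lam + k by rewrite addr_gt0.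
rewrite /peak mulr_gt0 ?powR_gt0 ?ypeak_gt0// /pot ell_ypeak.
rewrite divr_gt0// mulr_gt0 ?ypeak_gt0// subr_gt0 ltr_pdivrMr// mul1r.
by rewrite ltrDr.
Qed.

(** As [ell] decreases, the derivative [df] is nonnegative before [ypeak] and nonpositive after
    it. *)
Lemma pot_le_peak (y : R) : 0 < y -> y `^ k * pot y <= peak.
Proof.
move=> y0; pose df (y : R) := y `^ k * (((lam + k) * ell y + k) / lam).
have dfE (z : R) : 0 < z -> is_derive z 1 (fun y => y `^ k * pot y) (df z).
  move=> z0; have H := is_deriveMfun (is_derive1_powR k z0) (is_derive_pot z0).
  apply: is_derive_eq H _; rewrite /df /pot.
  have -> : z `^ k = z `^ (k - 1) * z by rewrite mulrC mulr_powRB1 ?ltW.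
  by field; rewrite gt_eqF.
have sgn (z : R) : 0 < z -> (0 <= (lam + k) * ell z + k) = (ell ypeak <= ell z).
  move=> z0; have lk : 0 < lam + k by rewrite addr_gt0.
  rewrite ell_ypeak lerNl ler_pdivlMr// -[RHS]subr_ge0.
  by congr (_ <= _); ring.
have fc (z : R) : 0 < z -> {for z, continuous (fun y => y `^ k * pot y)}.
  by move=> z0; exact: is_derive_continuous (dfE z z0).
have yp := ypeak_gt0.
have [yl|yl|yE] := ltgtP y ypeak; last by rewrite yE.
- have [||c /andP[yc cz] E] := @mean_value _ (fun y => y `^ k * pot y) df y ypeak yl.
  + by move=> x /andP[yx _]; apply: dfE; exact: lt_trans yx.
  + by move=> x /andP[yx _]; apply: fc; exact: lt_le_trans yx.
  have c0 := lt_trans y0 yc.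
  have d0 : 0 <= df c.
    rewrite /df mulr_ge0 ?powR_ge0// divr_ge0 ?(ltW lam0)// sgn//.
    by rewrite ltW// ell_decr.
  by rewrite -subr_ge0 /peak E mulr_ge0 ?subr_ge0 ?(ltW yl).
- have [||c /andP[yc cz] E] := @mean_value _ (fun y => y `^ k * pot y) df ypeak y yl.
  + by move=> x /andP[yx _]; apply: dfE; exact: lt_trans yx.
  + by move=> x /andP[yx _]; apply: fc; exact: lt_le_trans yx.
  have c0 := lt_trans yp yc.
  have d0 : df c <= 0.
    rewrite /df mulr_ge0_le0 ?powR_ge0// mulr_le0_ge0 ?invr_ge0 ?(ltW lam0)//.
    by rewrite ltW// ltNge sgn// -ltNge ell_decr.
  by rewrite -subr_le0 /peak E mulr_le0_ge0 ?subr_ge0 ?(ltW yl).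
Qed.

End Peak.
End Potential.

(** * Conjugate exponents *)

Lemma conj_expE {R : realType} (p : R) : conj_exp p = p / (p - 1).
Proof. by []. Qed.

Section Conjugate.
Context {R : realType}.
Variable p : R.
Hypothesis p1 : 1 < p.

Lemma conj_exp_gt1 : 1 < conj_exp p.
Proof. by rewrite /conj_exp ltr_pdivlMr ?subr_gt0// mul1r; lra. Qed.

Lemma conj_expV : (conj_exp p)^-1 = 1 - p^-1.
Proof.
have p0 : p != 0 by rewrite gt_eqF// (lt_trans ltr01).
have p1' : p - 1 != 0 by rewrite subr_eq0 gt_eqF.
by rewrite /conj_exp; field; rewrite ?p0 ?p1'.
Qed.

Lemma conj_exp_gt0 : 0 < conj_exp p.
Proof. exact: lt_trans ltr01 conj_exp_gt1. Qed.

Lemma conj_expD : p^-1 + (conj_exp p)^-1 = 1.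
Proof. by rewrite conj_expV addrC subrK. Qed.

Lemma powR_conjD (a : R) : 0 <= a -> a `^ (conj_exp p)^-1 * a `^ p^-1 = a.
Proof.
move=> a0; rewrite -powRD.
  by rewrite addrC conj_expD powRr1.
by rewrite addrC conj_expD oner_eq0.
Qed.

End Conjugate.

(** * The potential as a function of [u], and the two antiderivatives that compute integrals along a
    profile *)

Section ProfileFunctions.
Context {R : realType}.
Variables (lam p theta : R).
Hypotheses (lam0 : 0 < lam) (p1 : 1 < p) (theta0 : 0 < theta).

Let q := conj_exp p.

Definition pfun (v : R) : R := pot lam ((Num.max v 0) `^ theta).

(** Truncated because [pfun] is negative beyond [vmax]; the result is continuous on the whole line,
    as [antiderivative] requires. *)
Definition gfun (v : R) : R := (Num.max (pfun v) 0) `^ q^-1.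

Definition vmax : R := ymax lam `^ theta^-1.

Lemma vmax_gt0 : 0 < vmax.
Proof. by rewrite powR_gt0// ymax_gt0. Qed.

Lemma vmaxE : vmax `^ theta = ymax lam.
Proof. by rewrite -powRrM mulVf ?gt_eqF// powRr1// ltW// ymax_gt0. Qed.

Lemma pfunE (v : R) : 0 <= v -> pfun v = pot lam (v `^ theta).
Proof. by move=> v0; rewrite /pfun (max_idPl v0). Qed.

Lemma pfun_le0 (v : R) : v <= 0 -> pfun v = 0.
Proof. by move=> v0; rewrite /pfun (max_idPr v0) powR0 ?gt_eqF// pot0. Qed.

Lemma pfun_continuous (v : R) : {for v, continuous pfun}.
Proof.
have -> : pfun = (fun v => pot lam (Num.max ((Num.max v 0) `^ theta) 0)).
  by apply/funext => z; rewrite /pfun [Num.max (_ `^ _) 0](max_idPl _)// powR_ge0.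
apply: (@continuous_compfun _ (fun y => pot lam (Num.max y 0))).
  exact: powR_max0_continuous.
exact: pot_max0_continuous.
Qed.

Lemma gfun_continuous : continuous gfun.
Proof.
move=> v; apply: (@continuous_compfun _ (fun y => (Num.max y 0) `^ q^-1)).
  exact: pfun_continuous.
by apply: powR_max0_continuous; rewrite invr_gt0 conj_exp_gt0.
Qed.

Lemma pfun_gt0 (v : R) : 0 < v -> v < vmax -> 0 < pfun v.
Proof.
move=> v0 vm; rewrite pfunE ?ltW//; apply: pot_gt0 => //; first exact: powR_gt0.
by rewrite -vmaxE gt0_ltr_powR// nnegrE ltW// vmax_gt0.
Qed.

Lemma pfun_vmax : pfun vmax = 0.
Proof. by rewrite pfunE ?vmaxE ?pot_ymax// ltW// vmax_gt0. Qed.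

Lemma pfun_ge0 (v : R) : v <= vmax -> 0 <= pfun v.
Proof.
rewrite le_eqVlt => /predU1P[->|vm]; first by rewrite pfun_vmax.
by have [v0|v0] := leP v 0; [rewrite pfun_le0|rewrite ltW// pfun_gt0].
Qed.

Lemma is_derive_pfun (v : R) : 0 < v ->
  is_derive v 1 pfun (ell lam (v `^ theta) * (theta * v `^ (theta - 1))).
Proof.
move=> v0; have H := @is_derive_compfun _ (pot lam) (fun y => y `^ theta) _ _ _ (is_derive_pot lam0 (powR_gt0 theta v0))
  (is_derive1_powR theta v0).
have E (y : R) : `|y - v| < v -> pot lam (y `^ theta) = pfun y.
  by rewrite ltr_norml => /andP[zv _]; rewrite pfunE//; lra.
exact (is_derive_ball v0 E H).
Qed.

Lemma gfunE (v : R) : v <= vmax -> gfun v = pfun v `^ q^-1.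
Proof. by move=> vm; rewrite /gfun (max_idPl _)// pfun_ge0. Qed.

Lemma gfun_ge0 (v : R) : 0 <= gfun v.
Proof. exact: powR_ge0. Qed.

Lemma gfun_le0 (v : R) : v <= 0 -> gfun v = 0.
Proof.
by move=> v0; rewrite /gfun pfun_le0// maxxx powR0// invr_eq0 gt_eqF// conj_exp_gt0.
Qed.

Lemma gfun_gt0 (v : R) : 0 < v -> v < vmax -> 0 < gfun v.
Proof. by move=> v0 vm; rewrite gfunE ?ltW// powR_gt0// pfun_gt0. Qed.

Lemma gfun_vmax : gfun vmax = 0.
Proof. by rewrite gfunE// pfun_vmax powR0// invr_eq0 gt_eqF// conj_exp_gt0. Qed.

Lemma gfunM (v : R) : v <= vmax -> gfun v * pfun v `^ p^-1 = pfun v.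
Proof. by move=> vm; rewrite gfunE// powR_conjD// pfun_ge0. Qed.

Lemma gfunX (v : R) : v <= vmax -> gfun v `^ q = pfun v.
Proof.
move=> vm; rewrite gfunE// -powRrM mulVf ?powRr1 ?pfun_ge0//.
by rewrite gt_eqF// conj_exp_gt0.
Qed.

Definition Phi : R -> R := projT1 (cid (antiderivative gfun_continuous)).

Lemma is_derive_Phi (v : R) : is_derive v 1 Phi (gfun v).
Proof. by rewrite /Phi; case: cid => F /= /(_ v). Qed.

(** By [is_derive_Phi], the integral of [gfun] over [[0, vmax]]. *)
Definition Jphi : R := Phi vmax - Phi 0.

Lemma Jphi_gt0 : 0 < Jphi.
Proof.
have [||c /andP[c0 cv] E] := @mean_value _ Phi gfun 0 vmax vmax_gt0.
- by move=> x _; exact: is_derive_Phi.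
- by move=> x _; exact: is_derive_continuous (is_derive_Phi x).
by rewrite /Jphi E subr0 mulr_gt0 ?vmax_gt0// gfun_gt0.
Qed.

Let k := q / theta.

(* [Psi' * pfun `^ p^-1 = v `^ theta]: along [u' = - kap * pfun u `^ p^-1], the
   mass of [u `^ theta] is a difference of values of [- Psi / kap]. *)
Definition Psi (v : R) : R := (lam + k) * Phi v + - (k * (v * gfun v)).

Lemma Psi0 : Psi 0 = (lam + k) * Phi 0.
Proof. by rewrite /Psi mul0r mulr0 oppr0 addr0. Qed.

Lemma Psi_vmax : Psi vmax = (lam + k) * Phi vmax.
Proof. by rewrite /Psi gfun_vmax mulr0 mulr0 oppr0 addr0. Qed.

Lemma Psi_continuous (v : R) : {for v, continuous Psi}.
Proof.
apply: continuousDfun.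
  by apply: continuousZfun; exact: is_derive_continuous (is_derive_Phi v).
apply: continuousNfun; apply: continuousZfun.
by apply: continuousMfun; [exact: id|exact: gfun_continuous].
Qed.

(** Put [y = v^theta]. Since [k * theta / q = 1], the product of the derivative with [pfun^(1/p)] is
    [lam * pot y - y * ell y], and [lam * pot y = y + y * ell y]. At [vmax] the power [pfun^(1/q)]
    is not differentiable, hence the strict bound. *)
Lemma is_derive_Psi (v : R) : 0 <= v -> v < vmax ->
  exists2 d : R, is_derive v 1 Psi d & d * pfun v `^ p^-1 = v `^ theta.
Proof.
rewrite le_eqVlt => /predU1P[<- _|v0 vm].
  exists 0; last by rewrite mul0r powR0 ?gt_eqF.
  (* [gfun] need not be differentiable at 0, but it is itself the difference quotient of
     [v * gfun v] there. *)
  have dz : is_derive (0 : R) 1 (fun v : R => v * gfun v) 0.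
    apply/is_derive1_caratheodory; exists gfun; split.
    - by move=> z; rewrite mul0r !subr0 mulrC.
    - exact: gfun_continuous.
    - exact: gfun_le0.
  have H := is_deriveDfun (is_deriveZfun (lam + k) (is_derive_Phi 0))
    (is_deriveNfun (is_deriveZfun k dz)).
  by apply: is_derive_eq H _; rewrite gfun_le0// !mulr0 oppr0 addr0.
have W0 := pfun_gt0 v0 vm.
have dg : is_derive v 1 gfun
    (q^-1 * pfun v `^ (q^-1 - 1) * (ell lam (v `^ theta) * (theta * v `^ (theta - 1)))).
  have H := @is_derive_compfun _ (fun y => y `^ q^-1) pfun _ _ _ (is_derive1_powR q^-1 W0) (is_derive_pfun v0).
  have vm0 : 0 < vmax - v by rewrite subr_gt0.
  have E (y : R) : `|y - v| < vmax - v -> pfun y `^ q^-1 = gfun y.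
    by rewrite ltr_norml => /andP[_ zv]; rewrite gfunE//; lra.
  exact (is_derive_ball vm0 E H).
have H := is_deriveDfun (is_deriveZfun (lam + k) (is_derive_Phi v))
    (is_deriveNfun (is_deriveZfun k (is_deriveMfun (is_derive_idfun v) dg))).
eexists; first exact: H.
have -> : q^-1 - 1 = - p^-1 by rewrite -(conj_expD p1) /q; ring.
have vt : v * v `^ (theta - 1) = v `^ theta by rewrite mulr_powRB1 ?ltW.
have WE : pfun v = v `^ theta * (1 + ell lam (v `^ theta)) / lam by rewrite pfunE ?ltW.
have gM := gfunM (ltW vm).
have P0 : 0 < pfun v `^ p^-1 := powR_gt0 p^-1 W0.
have PP : (pfun v `^ p^-1)^-1 * pfun v `^ p^-1 = 1 := mulVf (lt0r_neq0 P0).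
have kq : k * q^-1 * theta = 1.
  by rewrite /k mulrAC (divfK (lt0r_neq0 theta0)) (divff (lt0r_neq0 (conj_exp_gt0 p1))).
have idn (L K g V QI PI l T t P : R) :
    ((L + K) * g + - (K * (V * (QI * PI * (l * (T * t))) + 1 * g))) * P =
    L * (g * P) - K * QI * T * (V * t) * l * (PI * P) by ring.
rewrite powRN idn.
rewrite gM PP kq WE vt; move: (v `^ theta) (ell _ _) => a b.
by field; rewrite gt_eqF.
Qed.

End ProfileFunctions.

(** Up to the factor [- gam / theta], the reaction term is the difference quotient at [l = 1] of
    [l -> v^(l * theta - 1)]. *)
Lemma reaction_limit {R : realType} (theta gam v : R) : theta != 0 -> 0 < v ->
  reaction_neq1 theta gam l v @[l --> (1 : R)^'] --> reaction_eq1 theta gam v.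
Proof.
move=> theta_neq0 v0.
pose F (l : R) := expR ((l * theta - 1) * ln v).
have FE (l : R) : F l = v `^ (l * theta - 1) by rewrite /powR gt_eqF.
have dF : is_derive (1 : R) 1 F (v `^ (theta - 1) * (theta * ln v)).
  have din : is_derive (1 : R) 1 (fun l : R => (l * theta - 1) * ln v) (theta * ln v).
    apply: is_derive_eq (is_deriveMfun (is_deriveDfun (is_deriveMfun (is_derive_idfun 1)
      (is_derive_cstfun theta 1)) (is_derive_cstfun (-1) 1)) (is_derive_cstfun (ln v) 1)) _.
    by ring.
  apply: is_derive_eq (is_derive_compfun (is_derive_expR _) din) _.
  by have := FE 1; rewrite /F mul1r => ->.
have [g [gE gc g1]] := (is_derive1_caratheodory _ _ _).1 dF.
have gc' : {for (1 : R), continuous (fun l => - (gam / theta) * g l)}.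
  exact: continuousZfun.
apply/cvgrPdist_lt => e e0; have [d d0 H] := (continuous_epsP _ _).1 gc' e e0.
apply/near_epsP; exists d => // l ld l1; have := H l ld.
rewrite distrC g1; congr (_ < _); congr `|_ - _|.
  by rewrite /reaction_eq1; field.
have nl1 : 1 - l != 0 by rewrite subr_eq0 eq_sym.
have := gE l; rewrite !FE mul1r /reaction_neq1 => ->.
by rewrite -(opprB 1 l) mulrN (mulNr _ (1 - l)^-1) (mulfK nl1) mulrN mulNr.
Qed.

(** * Level sets and integrals of densities *)

Section Integrals.
Context {R : realType}.
Local Notation leb := (@lebesgue_measure R).
Implicit Types (f g h F : R -> R) (a b c x y z e : R).

(** [b] is the least element of the compact set of points of [[a, z]] where [f <= e]; the
    intermediate value theorem turns this inequality into an equality at [b]. *)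
Lemma level_right f a z e : continuous f -> a <= z -> e < f a -> f z <= e ->
  exists b, [/\ a < b <= z, f b = e & forall x, a <= x < b -> e < f x].
Proof.
move=> fc az fa fz.
pose A := `[a, z] `&` f @^-1` [set y | y <= e].
have Ac : compact A.
  apply: (@subclosed_compact _ _ `[a, z]%classic).
  - apply: closedI; first exact: itv_closed.
    by apply: preimage_closed; [move=> x _; exact: fc|exact: closed_le].
  - exact: segment_compact.
  - by move=> x [].
have A0 : A !=set0 by exists z; split => //=; rewrite in_itv/= az lexx.
have [|b bA bmin] := @compact_EVT_min _ R id A A0 Ac.
  by apply: continuous_subspaceT => x; exact: id.
move: bA; rewrite inE => -[/=]; rewrite in_itv/= => /andP[ab bz] fb.
have ab' : a < b.
  by rewrite lt_neqAle ab andbT; apply/eqP => abE; move: fb; rewrite -abE; lra.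
have above x : a <= x < b -> e < f x.
  move=> /andP[ax xb]; rewrite ltNge; apply/negP => fx.
  have : b <= x; last by lra.
  by apply: bmin; rewrite inE; split => //=; rewrite in_itv/= ax/=; lra.
exists b; split => //; first by rewrite ab'.
have fe : Num.min (f a) (f b) <= e <= Num.max (f a) (f b).
  by rewrite ge_min le_max fb orbT (ltW fa).
have [c] := IVT ab (continuous_itvcc (fun x _ => fc x)) fe.
rewrite in_itv/= => /andP[ac cb] fce.
have [cb'|bc] := ltP c b; first by have := above c; rewrite ac cb' fce ltxx => /(_ isT).
by have <- : c = b by apply/eqP; rewrite eq_le cb bc.
Qed.

Lemma level_left f a z e : continuous f -> z <= a -> e < f a -> f z <= e ->
  exists b, [/\ z <= b < a, f b = e & forall x, b < x <= a -> e < f x].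
Proof.
move=> fc za fa fz.
have [||||b [/andP[ab bz] fb above]] := @level_right (fun x => f (- x)) (- a) (- z) e.
- by move=> x; apply: (@continuous_compfun _ f -%R); [exact: opp_continuous|exact: fc].
- by rewrite lerN2.
- by rewrite opprK.
- by rewrite opprK.
exists (- b); split => //; first by rewrite lerNr bz ltrNl.
by move=> x /andP[bx xa]; have := above (- x); rewrite opprK lerN2 xa ltrNl bx; exact.
Qed.

(** Otherwise [f >= e] on an interval of length [2 / e], which would carry a mass of at least 2. *)
Lemma density_small_right f x0 e : is_density f -> 0 < e ->
  exists2 x, x0 < x & f x < e.
Proof.
move=> [f0 mf fi] e0; apply/not_exists2P => H.
have fe x : x0 < x -> e <= f x.
  by move=> x0x; have [//|] := H x; rewrite leNgt => /negP.
pose I : set R := `]x0, x0 + 2 / e]%classic.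
have mI : measurable I by exact: measurable_itv.
have muI : leb I = (2 / e)%:E.
  rewrite /I lebesgue_measure_itv/= lte_fin ltrDl divr_gt0// -EFinD.
  by congr EFin; ring.
have : (\int[leb]_(x in I) (cst e%:E) x <= \int[leb]_x (f x)%:E)%E.
  apply: (@le_trans _ _ (\int[leb]_(x in I) (f x)%:E)%E).
    apply: ge0_le_integral => //.
    - by move=> x _; rewrite lee_fin ltW.
    - by apply/measurable_EFinP; exact: measurable_funTS.
    - by move=> x; rewrite /I /= in_itv/= lee_fin => /andP[/fe].
  apply: ge0_subset_integral => //; first exact/measurable_EFinP.
  by move=> x _; rewrite lee_fin.
rewrite fi integral_cst// [X in (_ * X)%E]muI -EFinM lee_fin.
by have -> : e * (2 / e) = 2; [field; rewrite gt_eqF|lra].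
Qed.

Lemma density_small_left f x0 e : is_density f -> 0 < e ->
  exists2 x, x < x0 & f x < e.
Proof.
move=> [f0 mf fi] e0; apply/not_exists2P => H.
have fe x : x < x0 -> e <= f x.
  by move=> x0x; have [//|] := H x; rewrite leNgt => /negP.
pose I : set R := `[x0 - 2 / e, x0[%classic.
have mI : measurable I by exact: measurable_itv.
have muI : leb I = (2 / e)%:E.
  rewrite /I lebesgue_measure_itv/= lte_fin gtrBl divr_gt0// -EFinD.
  by congr EFin; ring.
have : (\int[leb]_(x in I) (cst e%:E) x <= \int[leb]_x (f x)%:E)%E.
  apply: (@le_trans _ _ (\int[leb]_(x in I) (f x)%:E)%E).
    apply: ge0_le_integral => //.
    - by move=> x _; rewrite lee_fin ltW.
    - by apply/measurable_EFinP; exact: measurable_funTS.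
    - by move=> x; rewrite /I /= in_itv/= lee_fin => /andP[_ /fe].
  apply: ge0_subset_integral => //; first exact/measurable_EFinP.
  by move=> x _; rewrite lee_fin.
rewrite fi integral_cst// [X in (_ * X)%E]muI -EFinM lee_fin.
by have -> : e * (2 / e) = 2; [field; rewrite gt_eqF|lra].
Qed.

Lemma FTC_segment F f a b : a < b ->
  (forall x, a <= x <= b -> is_derive x 1 F (f x)) ->
  (forall x, a <= x <= b -> {for x, continuous f}) ->
  \int[leb]_(x in `[a, b]) f x = F b - F a.
Proof.
move=> ab dF fc; rewrite /Rintegral (@continuous_FTC2 _ f F a b ab)//.
- exact: continuous_itvcc.
- have Fc x : a <= x <= b -> {for x, continuous F}.
    by move=> xab; exact: is_derive_continuous (dF x xab).
  split.
  + move=> x; rewrite in_itv/= => /andP[ax xb].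
    by have [] := dF x _; first by rewrite !ltW.
  + by apply: cvg_at_right_filter; apply: Fc; rewrite lexx ltW.
  + by apply: cvg_at_left_filter; apply: Fc; rewrite lexx ltW.
- move=> x; rewrite in_itv/= => /andP[ax xb].
  by apply: is_derive_derive1; apply: dF; rewrite !ltW.
Qed.

Lemma variation_le F f h a b : a < b ->
  (forall x, a <= x <= b -> is_derive x 1 F (f x)) ->
  (forall x, a <= x <= b -> {for x, continuous f}) ->
  leb.-integrable `[a, b] (EFin \o h) ->
  (forall x, a <= x <= b -> f x <= h x) ->
  F b - F a <= \int[leb]_(x in `[a, b]) h x.
Proof.
move=> ab dF fc hi fh; rewrite -(FTC_segment ab dF fc).
by apply: le_Rintegral => //; exact: integrable_itvcc.
Qed.

Lemma measurable_posset f : continuous f -> measurable (posset f).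
Proof.
move=> fc; apply: measurable_realfun.open_measurable.
have -> : posset f = f @^-1` [set y | 0 < y] by [].
by apply: open_comp => [x _|]; [exact: fc|exact: open_gt].
Qed.

Lemma le_subset_Rintegral (A B : set R) h : measurable A -> measurable B ->
  A `<=` B -> leb.-integrable B (EFin \o h) -> (forall x, B x -> 0 <= h x) ->
  \int[leb]_(x in A) h x <= \int[leb]_(x in B) h x.
Proof.
move=> mA mB AB hB h0; rewrite /Rintegral fine_le//.
- by apply: integrable_fin_num => //; exact: integrableS hB.
- exact: integrable_fin_num.
- by apply: ge0_subset_integral => //; case/integrableP : hB.
Qed.

Lemma integrableDfun (A : set R) f g : measurable A ->
  leb.-integrable A (EFin \o f) -> leb.-integrable A (EFin \o g) ->
  leb.-integrable A (EFin \o (fun x => f x + g x)).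
Proof.
move=> mA fi gi; have -> : EFin \o (fun x => f x + g x) = ((EFin \o f) \+ (EFin \o g))%E.
  by apply/funext.
exact: integrableD.
Qed.

Lemma integrableZfun (A : set R) k f : measurable A ->
  leb.-integrable A (EFin \o f) -> leb.-integrable A (EFin \o (fun x => k * f x)).
Proof.
move=> mA fi; have -> : EFin \o (fun x => k * f x) = (fun x => k%:E * (EFin \o f) x)%E.
  by apply/funext.
exact: integrableZl.
Qed.

Lemma eq_Rintegral_fun (A : set R) f g : (forall x, A x -> f x = g x) ->
  \int[leb]_(x in A) f x = \int[leb]_(x in A) g x.
Proof. by move=> fg; apply: eq_Rintegral => x; rewrite inE; exact: fg. Qed.

Lemma eq_integrable_fun (A : set R) f g : measurable A ->
  (forall x, A x -> f x = g x) ->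
  leb.-integrable A (EFin \o f) -> leb.-integrable A (EFin \o g).
Proof.
move=> mA fg; apply: eq_integrable => // x; rewrite inE => Ax.
by rewrite /= fg.
Qed.

(* The two monotone runs, down from the level of [x0] to the level [e] on either
   side of [x0], are disjoint: hence the factor 2. *)
Lemma two_sided_variation (rho h psi Psi : R -> R) x0 e :
  is_density rho -> regular rho ->
  (forall r : R, 0 < r -> is_derive r 1 Psi (psi r)) ->
  (forall r : R, 0 < r -> {for r, continuous psi}) ->
  leb.-integrable (posset rho) (EFin \o h) ->
  (forall x, 0 < rho x -> `|psi (rho x) * derive1 rho x| <= h x) ->
  0 < e -> e < rho x0 ->
  2 * (Psi (rho x0) - Psi e) <= \int[leb]_(x in posset rho) h x.
Proof.
move=> rhoD [drho crho] dPsi cpsi hi hle e0 ex0.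
have rc : continuous rho.
  by move=> x; exact: is_derive_continuous (derivable_is_derive (drho x)).
have h0 x : posset rho x -> 0 <= h x.
  by move=> x0'; exact: le_trans (hle x x0').
have [z1 x0z1 z1e] := density_small_right x0 rhoD e0.
have [z2 z2x0 z2e] := density_small_left x0 rhoD e0.
have [b [/andP[x0b _] rb above]] := level_right rc (ltW x0z1) ex0 (ltW z1e).
have [a [/andP[_ ax0] ra above']] := level_left rc (ltW z2x0) ex0 (ltW z2e).
have posr x : x0 <= x <= b -> 0 < rho x.
  move=> /andP[x0x]; rewrite le_eqVlt => /predU1P[->|xb]; first by rewrite rb.
  by apply: lt_trans e0 _; apply: above; rewrite x0x.
have posl x : a <= x <= x0 -> 0 < rho x.
  move=> /andP[+ xx0]; rewrite le_eqVlt => /predU1P[<-|ax]; first by rewrite ra.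
  by apply: lt_trans e0 _; apply: above'; rewrite ax.
have dF x : 0 < rho x ->
    is_derive x 1 (fun y => Psi (rho y)) (psi (rho x) * derive1 rho x).
  by move=> rx; exact: (is_derive_compfun (dPsi _ rx) (derivable_is_derive (drho x))).
have cF x : 0 < rho x -> {for x, continuous (fun x => psi (rho x) * derive1 rho x)}.
  move=> rx; apply: continuousMfun; last exact: crho.
  by apply: continuous_compfun; [exact: rc|exact: cpsi].
have mP := measurable_posset rc.
have sub c d : (forall x, c <= x <= d -> 0 < rho x) -> `[c, d] `<=` posset rho.
  by move=> cd x /=; rewrite in_itv/=; exact: cd.
have intS (A : set R) : measurable A -> A `<=` posset rho ->
    leb.-integrable A (EFin \o h).
  by move=> mA AP; exact: integrableS hi.
have left : Psi (rho x0) - Psi e <= \int[leb]_(x in `[a, x0]) h x.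
  rewrite -ra; apply: (@variation_le (fun x => Psi (rho x))
    (fun x => psi (rho x) * derive1 rho x) h) => //.
  - by move=> x /posl; exact: dF.
  - by move=> x /posl; exact: cF.
  - by apply: intS => //; exact: sub.
  - by move=> x /posl rx; exact: le_trans (ler_norm _) (hle x rx).
have right : Psi (rho x0) - Psi e <= \int[leb]_(x in `[x0, b]) h x.
  rewrite -rb -[Psi (rho x0)]opprK addrC.
  apply: (@variation_le (fun x => - Psi (rho x))
    (fun x => - (psi (rho x) * derive1 rho x)) h) => //.
  - by move=> x /posr rx; exact: (is_deriveNfun (dF _ rx)).
  - by move=> x /posr rx; exact: (continuousNfun (cF _ rx)).
  - by apply: intS => //; exact: sub.
  - by move=> x /posr rx; rewrite (le_trans (ler_norm _))// normrN hle.
have subU : `[a, x0] `|` `]x0, b] `<=` posset rho.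
  move=> x /= [|]; rewrite in_itv/=; first exact: posl.
  by move=> /andP[x0x xb]; apply: posr; rewrite ltW.
apply: le_trans (le_subset_Rintegral _ mP subU hi h0); last exact: measurableU.
rewrite Rintegral_setU//.
- rewrite Rintegral_itv_obnd_cbnd ?mulr_natl ?mulr2n ?lerD//.
  by apply: intS => //; apply: subset_trans subU; exact: subsetUr.
- by apply: intS => //; exact: measurableU.
- apply/disj_set2P; rewrite -subset0 => x /= []; rewrite !in_itv/=.
  by move=> /andP[_ xx0] /andP[x0x _]; move: (lt_le_trans x0x xx0); rewrite ltxx.
Qed.

End Integrals.

(** * The lower bound *)

Section Young.
Context {R : realType}.

(** Young's inequality for [t * a] and [b / t]. The weight [t] stays free until after integration,
    where optimizing it replaces Hölder's inequality. *)
Lemma young_scaled (p a b t : R) : 1 < p -> 0 <= a -> 0 <= b -> 0 < t ->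
  a * b <= t `^ p / p * a `^ p + t `^ (- conj_exp p) / conj_exp p * b `^ conj_exp p.
Proof.
move=> p1 a0 b0 t0; have p0 : 0 < p by lra.
have q0 := conj_exp_gt0 p1.
have ti : 0 <= t^-1 by rewrite invr_ge0 ltW.
have := conjugate_powR (mulr_ge0 (ltW t0) a0) (mulr_ge0 ti b0) p0 q0 (conj_expD p1).
rewrite !powRM// ?(ltW t0)// -[t^-1]powR_inv1 ?(ltW t0)// -powRrM mulN1r.
rewrite powR_inv1 ?(ltW t0)//.
have -> : t * a * (t^-1 * b) = a * b by field; rewrite gt_eqF.
by rewrite ![_ * _ / _]mulrAC.
Qed.

(** The best weight is [t^(p q) = Q / P]: both terms become multiples of the same product, with
    coefficients [1/p] and [1/q]. For [P = 0], a large [t] contradicts [0 < L]. *)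
Lemma young_optimal (p L P Q : R) : 1 < p -> 0 < L -> 0 <= P -> 0 < Q ->
  (forall t, 0 < t ->
     L <= t `^ p / p * P + t `^ (- conj_exp p) / conj_exp p * Q) ->
  L <= P `^ p^-1 * Q `^ (conj_exp p)^-1.
Proof.
move=> p1 L0 P0 Q0 H; have p0 : 0 < p by lra.
have q0 := conj_exp_gt0 p1; set q := conj_exp p in H q0 *.
have pq : p^-1 + q^-1 = 1 := conj_expD p1.
move: P0; rewrite le_eqVlt => /predU1P[P0|P0]; last first.
  have QP : 0 < Q / P by rewrite divr_gt0.
  have := H ((Q / P) `^ (p^-1 * q^-1)) (powR_gt0 _ QP).
  rewrite -!powRrM.
  have -> : p^-1 * q^-1 * p = q^-1 by field; rewrite !gt_eqF.
  have -> : p^-1 * q^-1 * - q = - p^-1 by field; rewrite !gt_eqF.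
  have Pi : 0 <= P^-1 by rewrite invr_ge0 ltW.
  have P1 : P = P `^ p^-1 * P `^ q^-1.
    by rewrite -powRD ?pq ?powRr1 ?oner_eq0// ltW.
  have Q1 : Q = Q `^ p^-1 * Q `^ q^-1.
    by rewrite -powRD ?pq ?powRr1 ?oner_eq0// ltW.
  rewrite !powRM ?(ltW Q0)// !powRN.
  rewrite -[P^-1]powR_inv1 ?(ltW P0)// -!powRrM !mulN1r !powRN.
  have Pp : 0 < P `^ p^-1 by rewrite powR_gt0.
  have Pq : 0 < P `^ q^-1 by rewrite powR_gt0.
  have Qp : 0 < Q `^ p^-1 by rewrite powR_gt0.
  move: P1 Q1 Pp Pq Qp; move: (P `^ p^-1) (P `^ q^-1) (Q `^ p^-1) (Q `^ q^-1).
  move=> a b c d -> -> a0 b0 c0.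
  suff -> : d * b^-1 / p * (a * b) + c^-1 / a^-1 / q * (c * d) = a * d * (p^-1 + q^-1).
    by rewrite pq mulr1.
  by field; rewrite !gt_eqF.
(* With [P = 0] and [t^q = 2 Q / (L q)] the right-hand side is [L / 2]. *)
have X0 : 0 < 2 * Q / (L * q) by apply: divr_gt0; apply: mulr_gt0.
have := H ((2 * Q / (L * q)) `^ q^-1) (powR_gt0 _ X0).
rewrite -P0 mulr0 add0r -powRrM mulrN mulVf ?gt_eqF// powR_inv1 ?(ltW X0)//.
have -> : (2 * Q / (L * q))^-1 / q * Q = L / 2.
  have Ln := lt0r_neq0 L0; have Qn := lt0r_neq0 Q0; have qn := lt0r_neq0 q0.
  by field; rewrite Ln Qn qn.
by move=> ?; exfalso; lra.
Qed.

End Young.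

Section LowerBound.
Context {R : realType}.
Variables (p beta lam : R).
Hypotheses (p1 : 1 < p) (hD : Dp p (beta, lam)).
Local Notation leb := (@lebesgue_measure R).
Local Notation q := (conj_exp p).
Local Notation theta := (vartheta p beta).
Local Notation al := (theta^-1).
Local Notation k := (q / theta).

Lemma lam_gt0 : 0 < lam. Proof. by case: hD. Qed.

Lemma beta_gt0 : 0 < beta. Proof. by case: hD. Qed.

Lemma betaE : beta = al + q^-1.
Proof.
have q0 := conj_exp_gt0 p1; case: hD => /= _ _ bq _.
rewrite /vartheta invf_div; field.
by rewrite gt_eqF.
Qed.

Lemma theta_gt0 : 0 < theta.
Proof.
have q0 := conj_exp_gt0 p1; case: hD => /= _ _ bq _.
by rewrite /vartheta divr_gt0// subr_gt0 -ltr_pdivrMr// mul1r.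
Qed.

(** This is where the upper end of the range of [beta] enters. It makes [mu * u^theta]
    differentiable at the zeros of [u]. *)
Lemma theta_ge1 : 1 <= theta.
Proof.
case: hD => /= _ _ _ bq; rewrite -[theta]invrK invf_ge1 ?invr_gt0 ?theta_gt0//.
have : Num.min 1 lam <= 1 by rewrite ge_min lexx.
by move: bq; rewrite {1}betaE; lra.
Qed.

(** The exponents [beta - 1] of the weight, [-1] of the logarithmic derivative and [1/p] of the
    factor [rho] add up to [al - 1], because [beta = al + 1/q]. *)
Lemma fisher_integrandE (rho : R -> R) x : derivable rho x 1 -> 0 < rho x ->
  fisher_integrand p beta rho x = (`|derive1 rho x| * rho x `^ (al - 1)) `^ p.
Proof.
move=> dr rx; have p0 : 0 < p := lt_trans ltr01 p1.
have dl := is_derive_compfun (is_derive1_ln rx) (derivable_is_derive dr).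
rewrite /fisher_integrand (is_derive_derive1 dl) !normrM.
rewrite (ger0_norm (powR_ge0 _ _)) (gtr0_norm (_ : 0 < (rho x)^-1)) ?invr_gt0//.
rewrite -[X in _ * X](_ : (rho x `^ p^-1) `^ p = _); last first.
  by rewrite -powRrM mulVf ?gt_eqF// powRr1// ltW.
have rn : rho x != 0 by rewrite gt_eqF.
have ri : 0 <= (rho x)^-1 by rewrite invr_ge0 ltW.
have D0 : 0 <= rho x `^ (beta - 1) * ((rho x)^-1 * `|derive1 rho x|).
  by apply: mulr_ge0; [exact: powR_ge0|exact: mulr_ge0].
rewrite -(powRM _ D0 (powR_ge0 (rho x) p^-1)).
congr (_ `^ _); rewrite -[(rho x)^-1]powR_inv1 ?(ltW rx)//.
rewrite mulrA mulrAC mulrC -!powRD ?rn ?implybT//; congr (_ * _ `^ _).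
by rewrite {1}betaE (conj_expV p1); ring.
Qed.

(** Isolates the two quantities to be estimated: the power [1/p] of the Fisher integral is a factor
    in [young_optimal], and [exp(beta * H)] will come out of [Q^(1/q)]. *)
Lemma complexityE (rho : R -> R) :
  complexity p beta lam rho =
  ((Rintegral leb (posset rho) (fisher_integrand p beta rho)) `^ p^-1 *
   expR (beta * renyi_entropy lam rho)) ^+ 2.
Proof.
have p0 : 0 < p := lt_trans ltr01 p1.
have b0 := beta_gt0.
rewrite /complexity /fisher /renyi_power; set P := Rintegral _ _ _.
set H := renyi_entropy _ _.
have P0 : 0 <= P.
  by apply: Rintegral_ge0 => x rx; rewrite mulr_ge0 ?powR_ge0// ltW.
rewrite powRM ?powR_ge0 ?expR_ge0// -powRrM -expRM.
rewrite -powR_mulrn ?mulr_ge0 ?powR_ge0 ?expR_ge0// powRM ?powR_ge0 ?expR_ge0//.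
rewrite -powRrM -expRM; congr (_ `^ _ * expR _); last by ring.
by field; rewrite !gt_eqF.
Qed.

Lemma density_pos (rho : R -> R) : is_density rho -> exists x, 0 < rho x.
Proof.
move=> [r0 mr ri]; apply/not_existsP => H.
have : (\int[leb]_x (rho x)%:E = 0)%E.
  apply: integral0_eq => x _; congr EFin; apply/eqP.
  by rewrite eq_le r0 andbT leNgt; apply/negP; exact: H.
by rewrite ri => /eqP; rewrite onee_eq0.
Qed.

Lemma density_integrable (rho : R -> R) : is_density rho ->
  leb.-integrable [set: R] (EFin \o rho) /\ \int[leb]_x rho x = 1.
Proof.
move=> [r0 mr ri]; split; last by rewrite /Rintegral ri.
apply/integrableP; split; first exact/measurable_EFinP.
have -> : (\int[leb]_x `|(EFin \o rho) x| = \int[leb]_x (rho x)%:E)%E.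
  by apply: eq_integral => x _; rewrite /= ger0_norm.
by rewrite ri ltry.
Qed.

(** A zero integral would force [rho = 0] almost everywhere. Positivity is what allows [exp] to undo
    [ln] in [ell_integral]. *)
Lemma powR_integral_gt0 (rho : R -> R) : is_density rho ->
  leb.-integrable [set: R] (EFin \o (fun x => rho x `^ lam)) ->
  0 < \int[leb]_x (rho x `^ lam).
Proof.
move=> rhoD li; have [r0 mr ri] := rhoD.
have I0 : 0 <= \int[leb]_x (rho x `^ lam) by apply: Rintegral_ge0 => x _; exact: powR_ge0.
rewrite lt_neqAle I0 andbT eq_sym; apply/eqP => I00.
have : (\int[leb]_x `|(rho x `^ lam)%:E| = 0)%E.
  have -> : (\int[leb]_x `|(rho x `^ lam)%:E| = \int[leb]_x (rho x `^ lam)%:E)%E.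
    by apply: eq_integral => x _; rewrite /= ger0_norm ?powR_ge0.
  rewrite -[LHS]fineK; first by congr EFin.
  exact: integrable_fin_num li.
have mli : measurable_fun [set: R] (fun x => (rho x `^ lam)%:E) by case/integrableP : li.
move=> I1; have ae0 := (ae_eq_integral_abs leb measurableT mli).1 I1.
have : (\int[leb]_x (rho x)%:E = \int[leb]_x (cst 0 x))%E.
  apply: ae_eq_integral => //; first exact/measurable_EFinP.
  move: ae0; apply: filterS => x /(_ I) /= [] /powR_eq0_eq0 rx _.
  by rewrite rx.
by rewrite ri integral0 => /eqP; rewrite onee_eq0.
Qed.

(** [exp(- H)] is the quasi-arithmetic mean, with respect to [ell], of the values of [rho] under the
    probability [rho dx]. Such a mean is homogeneous when [ell] comes from a power or a logarithm,
    which accounts for [a]. *)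
Lemma ell_integral (rho : R -> R) (a : R) : is_density rho ->
  leb.-integrable [set: R] (EFin \o renyi_integrand lam rho) -> 0 < a ->
  leb.-integrable [set: R] (EFin \o (fun x => a * rho x * ell lam (a * rho x))) /\
  \int[leb]_x (a * rho x * ell lam (a * rho x)) =
    a * ell lam (a * expR (- renyi_entropy lam rho)).
Proof.
move=> rhoD li a0; have [r0 mr _] := rhoD; have [ri rI] := density_integrable rhoD.
have lam0 := lam_gt0.
have [l1|l1] := eqVneq lam 1.
  have l1b : (lam == 1) = true by rewrite l1 eqxx.
  have rE : renyi_integrand lam rho = (fun x => rho x * ln (rho x)).
    by apply/funext => x; rewrite /renyi_integrand l1b.
  rewrite rE in li.
  have E x : - (a * ln a) * rho x + - a * (rho x * ln (rho x)) =
      a * rho x * ell lam (a * rho x).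
    rewrite /ell l1b; have := r0 x; rewrite le_eqVlt => /predU1P[<-|rx].
      by rewrite !mulr0 !mul0r mulr0 addr0.
    by rewrite lnM ?posrE//; ring.
  have i1 := integrableZfun (- (a * ln a)) measurableT ri.
  have i2 := integrableZfun (- a) measurableT li.
  split; first by apply: eq_integrable_fun (integrableDfun measurableT i1 i2).
  rewrite -(eq_Rintegral_fun (fun x _ => E x)) RintegralD// !RintegralZl// rI.
  rewrite /ell l1b lnM ?posrE ?expR_gt0// expRK /renyi_entropy l1b rE.
  by ring.
have l1' : 1 - lam != 0 by rewrite subr_eq0 eq_sym.
have rE : renyi_integrand lam rho = (fun x => rho x `^ lam).
  by apply/funext => x; rewrite /renyi_integrand (negPf l1).
rewrite rE in li.
have E x : a `^ lam / (1 - lam) * (rho x `^ lam) + - (a / (1 - lam)) * rho x =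
    a * rho x * ell lam (a * rho x).
  have rx := r0 x; have arx : 0 <= a * rho x by rewrite mulr_ge0 ?(ltW a0).
  rewrite /ell (negPf l1) mulrA mulrBr mulr1 mulr_powRB1// powRM ?(ltW a0)//.
  by rewrite mulrBl; ring.
have i1 := integrableZfun (a `^ lam / (1 - lam)) measurableT li.
have i2 := integrableZfun (- (a / (1 - lam))) measurableT ri.
split; first by apply: eq_integrable_fun (integrableDfun measurableT i1 i2).
rewrite -(eq_Rintegral_fun (fun x _ => E x)) RintegralD// !RintegralZl// rI.
have B0 := powR_integral_gt0 rhoD li.
rewrite /ell (negPf l1) /renyi_entropy (negPf l1) rE.
set B := Rintegral _ _ _ in B0 *.
rewrite powRM ?expR_ge0 ?(ltW a0)// -expRM.
have -> : - ((1 - lam)^-1 * ln B) * (lam - 1) = ln B by field.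
by rewrite lnK ?posrE// -(mulr_powRB1 (ltW a0) lam0); ring.
Qed.

(** [lam * pot y = y + y * ell y]: the first term integrates to [a], the second is
    [ell_integral]. *)
Lemma pot_integral (rho : R -> R) (a : R) : is_density rho ->
  leb.-integrable [set: R] (EFin \o renyi_integrand lam rho) -> 0 < a ->
  leb.-integrable [set: R] (EFin \o (fun x => pot lam (a * rho x))) /\
  \int[leb]_x (pot lam (a * rho x)) =
    expR (renyi_entropy lam rho) * pot lam (a * expR (- renyi_entropy lam rho)).
Proof.
move=> rhoD li a0; have [r0 mr _] := rhoD; have [ri rI] := density_integrable rhoD.
have [ei eI] := ell_integral rhoD li a0.
have E x : a / lam * rho x + lam^-1 * (a * rho x * ell lam (a * rho x)) =
    pot lam (a * rho x) by rewrite /pot; ring.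
have i1 := integrableZfun (a / lam) measurableT ri.
have i2 := integrableZfun (lam^-1) measurableT ei.
split; first by apply: eq_integrable_fun (integrableDfun measurableT i1 i2).
rewrite -(eq_Rintegral_fun (fun x _ => E x)) RintegralD// !RintegralZl// rI eI /pot.
rewrite expRN; set e := expR _; have e0 : e != 0 by rewrite gt_eqF ?expR_gt0.
by field; rewrite e0 gt_eqF ?lam_gt0.
Qed.

Section Admissible.
Variable rho : R -> R.
Hypothesis rhoA : admissible p beta lam rho.

Let rhoD : is_density rho. Proof. by case: rhoA. Qed.
Let rhoR : regular rho. Proof. by case: rhoA. Qed.
Let rho_c : continuous rho.
Proof.
by move=> x; case: rhoR => dr _; exact: is_derive_continuous (derivable_is_derive (dr x)).
Qed.
Let mP : measurable (posset rho). Proof. exact: measurable_posset. Qed.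
Let fisher_int : leb.-integrable (posset rho) (EFin \o fisher_integrand p beta rho).
Proof. by case: rhoA => _ _ []. Qed.
Let renyi_int : leb.-integrable [set: R] (EFin \o renyi_integrand lam rho).
Proof. by case: rhoA => _ _ []. Qed.

Let P := Rintegral leb (posset rho) (fisher_integrand p beta rho).

(* Young's inequality for [|rho'| rho^(al-1)] and [g rho], integrated along the
   two runs of [two_sided_variation]. *)
Lemma young_variation (g Psi : R -> R) (t x0 e : R) :
  (forall r : R, 0 < r -> is_derive r 1 Psi (r `^ (al - 1) * g r)) ->
  (forall r : R, 0 < r -> {for r, continuous g}) ->
  (forall x, 0 < rho x -> 0 <= g (rho x)) ->
  leb.-integrable (posset rho) (EFin \o (fun x => g (rho x) `^ q)) ->
  0 < t -> 0 < e -> e < rho x0 ->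
  2 * (Psi (rho x0) - Psi e) <=
    t `^ p / p * P + t `^ (- q) / q * \int[leb]_(x in posset rho) (g (rho x) `^ q).
Proof.
move=> dPsi gc g0 gi t0 e0 ex0.
have i1 := integrableZfun (t `^ p / p) mP fisher_int.
have i2 := integrableZfun (t `^ (- q) / q) mP gi.
rewrite /P -!RintegralZl// -RintegralD//.
apply: (two_sided_variation rhoD rhoR dPsi _ (integrableDfun mP i1 i2) _ e0 ex0).
  move=> r r0; apply: continuousMfun; last exact: gc.
  exact: is_derive_continuous (is_derive1_powR (al - 1) r0).
move=> x rx; rewrite fisher_integrandE//; last by case: rhoR.
have D0 : 0 <= `|derive1 rho x| * rho x `^ (al - 1) by rewrite mulr_ge0 ?powR_ge0.
apply: le_trans (young_scaled p1 D0 (g0 x rx) t0).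
rewrite !normrM (ger0_norm (powR_ge0 _ _)) (ger0_norm (g0 x rx)).
by rewrite mulrC mulrA.
Qed.

(* [young_variation] with [g r = r `^ q^-1], along the runs from the level
   [rho x] down to [rho x / 2]. *)
Lemma rho_bounded : exists M, forall x, rho x <= M.
Proof.
have b0 := beta_gt0; have q0 := conj_exp_gt0 p1.
have [ri rI] := density_integrable rhoD.
pose S := p^-1 * P + q^-1 * \int[leb]_(x in posset rho) rho x.
(* The fraction of [rho x ^ beta] that is lost on the run down to the level [rho x / 2]. *)
pose c : R := 1 - 2^-1 `^ beta.
have c0 : 0 < c.
  have : (2^-1 : R) `^ beta < 1 `^ beta.
    by apply: gt0_ltr_powR; rewrite ?nnegrE ?invr_ge0// invf_lt1// ltr1n.
  by rewrite powR1 subr_gt0.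
exists ((beta * S / (2 * c)) `^ beta^-1) => x.
have [rx|rx] := leP (rho x) 0; first exact: le_trans rx (powR_ge0 _ _).
have rE y : posset rho y -> (rho y `^ q^-1) `^ q = rho y.
  move=> ry; rewrite -powRrM mulVf ?gt_eqF// powRr1//.
  exact: ltW.
have /= := @young_variation (fun r => r `^ q^-1) (fun r => beta^-1 * r `^ beta) 1 x (rho x / 2).
rewrite (eq_Rintegral_fun rE) !powR1 !mul1r => H.
have {}H : 2 * (beta^-1 * rho x `^ beta - beta^-1 * (rho x / 2) `^ beta) <= S.
  apply: H => //.
  - move=> r r0; apply: is_derive_eq (is_deriveZfun beta^-1 (is_derive1_powR beta r0)) _.
    rewrite mulrA mulVf ?gt_eqF// mul1r -powRD ?(gt_eqF r0) ?implybT//.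
    by congr (_ `^ _); rewrite {1}betaE; ring.
  - by move=> r r0; exact: is_derive_continuous (is_derive1_powR q^-1 r0).
  - by move=> y _; exact: powR_ge0.
  - apply: (@eq_integrable_fun _ _ rho _ mP); first by move=> y ry; rewrite rE.
    exact: integrableS ri.
  - by rewrite divr_gt0.
  - by rewrite ltr_pdivrMr// ltr_pMr// ltr1n.
have pm : (rho x / 2) `^ beta = rho x `^ beta * 2^-1 `^ beta.
  by rewrite powRM// ?invr_ge0// ltW.
rewrite pm in H.
have {}H : rho x `^ beta <= beta * S / (2 * c).
  rewrite ler_pdivlMr ?mulr_gt0// -ler_pdivrMl//.
  apply: le_trans H; rewrite /c le_eqVlt; apply/orP; left; apply/eqP.
  by move: (beta^-1) (rho x `^ beta) (2^-1 `^ beta) => a b c'; ring.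
have -> : rho x = (rho x `^ beta) `^ beta^-1.
  by rewrite -powRrM mulfV ?gt_eqF// powRr1// ltW.
apply: ge0_ler_powR => //; rewrite ?nnegrE ?powR_ge0 ?invr_ge0 ?(ltW b0)//.
exact: le_trans (powR_ge0 _ _) H.
Qed.

Let lam0 := lam_gt0.
Let theta0 := theta_gt0.
Let J := Jphi lam0 p1 theta0.

(* [young_variation] with [g r = pot lam (r / mu) `^ q^-1] and
   [mu = sup rho / ymax lam], the smallest [mu] that keeps the argument of [pot]
   where [pot] is nonnegative. *)
Lemma le_complexity :
  (2 * theta * J / peak lam k `^ q^-1) ^+ 2 <= complexity p beta lam rho.
Proof.
have [M0 Mb] := rho_bounded; have [x1 rx1] := density_pos rhoD.
have q0 := conj_exp_gt0 p1.
have al0 : 0 < al by rewrite invr_gt0.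
have k0 : 0 < k by rewrite divr_gt0.
have J0 : 0 < J by exact: Jphi_gt0.
have hs : has_sup (range rho).
  by split; [exists (rho x1), x1|exists M0 => _ [x _ <-]].
pose M := sup (range rho).
have rM x : rho x <= M by apply: sup_upper_bound => //; exists x.
have M_gt0 : 0 < M by exact: lt_le_trans (rM x1).
have ym0 := @ymax_gt0 _ lam lam0.
pose mu : R := M / ymax lam.
have mu0 : 0 < mu by rewrite divr_gt0.
have mun := lt0r_neq0 mu0.
(* The antiderivative of [r^(al - 1) * g r] by the substitution [v = (r / mu)^al], for which
   [r^(al - 1) dr = mu^al * theta dv]. It stays continuous at 0, where the derivative may blow
   up. *)
pose phi (r : R) := mu `^ al * theta * Phi lam0 p1 theta0 ((Num.max (mu^-1 * r) 0) `^ al).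
pose g (r : R) := gfun lam p theta ((mu^-1 * r) `^ al).
have g_c (r : R) : 0 < r -> {for r, continuous g}.
  move=> r0; have mr0 : 0 < mu^-1 * r by rewrite mulr_gt0 ?invr_gt0.
  apply: (@continuous_compfun _ (gfun lam p theta) (fun r => (mu^-1 * r) `^ al));
    last exact: gfun_continuous.
  apply: (@continuous_compfun _ (fun y => y `^ al) (fun r => mu^-1 * r)).
    exact: is_derive_continuous (is_deriveZfun mu^-1 (is_derive_idfun r)).
  exact: is_derive_continuous (is_derive1_powR al mr0).
have phi_c (r : R) : {for r, continuous phi}.
  apply: continuousZfun.
  apply: (@continuous_compfun _ (Phi lam0 p1 theta0)
    (fun r => (Num.max (mu^-1 * r) 0) `^ al)); last first.
    exact: is_derive_continuous (is_derive_Phi lam0 p1 theta0 _).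
  apply: (@continuous_compfun _ (fun y => (Num.max y 0) `^ al) (fun r => mu^-1 * r)).
    exact: is_derive_continuous (is_deriveZfun mu^-1 (is_derive_idfun r)).
  exact: powR_max0_continuous.
have dphi (r : R) : 0 < r -> is_derive r 1 phi (r `^ (al - 1) * g r).
  move=> r0; have mr0 : 0 < mu^-1 * r by rewrite mulr_gt0 ?invr_gt0.
  have d1 := @is_derive_compfun _ (fun y => y `^ al) (fun r => mu^-1 * r) r _ _
    (is_derive1_powR al mr0) (is_deriveZfun mu^-1 (is_derive_idfun r)).
  have d2 := @is_derive_compfun _ (Phi lam0 p1 theta0) (fun r => (mu^-1 * r) `^ al) r _ _
    (is_derive_Phi lam0 p1 theta0 _) d1.
  have d3 := is_deriveZfun (mu `^ al * theta) d2.
  have E (y : R) : `|y - r| < r -> mu `^ al * theta * Phi lam0 p1 theta0 ((mu^-1 * y) `^ al) = phi y.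
    rewrite ltr_norml => /andP[ry _]; rewrite /phi (max_idPl _)// mulr_ge0 ?invr_ge0 ?(ltW mu0)//.
    by lra.
  apply: is_derive_eq (is_derive_ball r0 E d3) _.
  rewrite -/(g r) mulr1.
  have muE : mu `^ al * (mu^-1 * r) `^ (al - 1) * mu^-1 = r `^ (al - 1).
    have miE : mu^-1 `^ (al - 1) = mu `^ (1 - al).
      rewrite -[mu^-1]powR_inv1 ?(ltW mu0)// -powRrM.
      by congr (_ `^ _); ring.
    have mm : mu `^ al * mu `^ (1 - al) = mu.
      rewrite -powRD ?mun ?implybT//.
      by have -> : al + (1 - al) = 1 by [ring]; rewrite powRr1 ?(ltW mu0).
    have mi0 : 0 <= mu^-1 by rewrite invr_ge0 ltW.
    rewrite (powRM _ mi0 (ltW r0)) miE mulrA mm.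
    by rewrite mulrAC mulfV ?mul1r.
  rewrite -muE; move: (mu `^ al) ((_ * _) `^ _) (g r) (mu^-1) => a b c d.
  by field; rewrite gt_eqF.
have vE (r : R) : 0 <= r -> ((mu^-1 * r) `^ al) `^ theta = mu^-1 * r.
  move=> r0; rewrite -powRrM mulVf ?gt_eqF// powRr1// mulr_ge0// invr_ge0.
  exact: ltW.
have muM : mu^-1 * M = ymax lam by rewrite /mu invf_div divfK ?(lt0r_neq0 M_gt0).
have vM x : 0 < rho x -> (mu^-1 * rho x) `^ al <= vmax lam theta.
  move=> rx; rewrite /vmax ge0_ler_powR ?nnegrE ?(ltW al0) ?(ltW ym0)//.
    by rewrite mulr_ge0 ?invr_ge0 ?ltW.
  by rewrite -muM ler_wpM2l// invr_ge0 ltW.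
have gq x : posset rho x -> pot lam (mu^-1 * rho x) = g (rho x) `^ q.
  by move=> rx; rewrite /g gfunX ?vM// pfunE ?powR_ge0// vE// ltW.
have mi : 0 < mu^-1 by rewrite invr_gt0.
have [poti potI] := pot_integral rhoD renyi_int mi.
have poti' : leb.-integrable (posset rho) (EFin \o (fun x => pot lam (mu^-1 * rho x))).
  exact: integrableS poti.
have gi : leb.-integrable (posset rho) (EFin \o (fun x => g (rho x) `^ q)).
  by apply: eq_integrable_fun mP gq poti'.
set H := renyi_entropy lam rho in potI *.
pose y := mu^-1 * expR (- H).
have y0 : 0 < y by rewrite mulr_gt0 ?expR_gt0.
have pk0 := @peak_gt0 _ lam lam0 k k0.
(* By [pot_integral] the integral of [g(rho)^q] is at most [exp(H) * pot y], and [pot_le_peak]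
   bounds [pot y] by [y^(-k) * peak]. *)
pose Q := expR H * (y `^ (- k) * peak lam k).
have Q0 : 0 < Q.
  by apply: mulr_gt0; [exact: expR_gt0|apply: mulr_gt0 => //; exact: powR_gt0].
have QI : \int[leb]_(x in posset rho) (g (rho x) `^ q) <= Q.
  rewrite -(eq_Rintegral_fun gq).
  apply: (@le_trans _ _ (\int[leb]_x pot lam (mu^-1 * rho x))).
    apply: le_subset_Rintegral => // x _; have [rx|rx] := ltP 0 (rho x).
      by rewrite (gq x rx) powR_ge0.
    have -> : rho x = 0 by apply/eqP; rewrite eq_le rx; case: rhoD => ->.
    by rewrite mulr0 pot0.
  rewrite potI -/y; apply: ler_wpM2l; first exact: expR_ge0.
  rewrite powRN [X in _ <= X]mulrC ler_pdivlMr; last exact: powR_gt0.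
  by rewrite [X in X <= _]mulrC; exact: pot_le_peak.
have mal : 0 < mu `^ al by rewrite powR_gt0.
have L0 : 0 < 2 * (mu `^ al * theta * J).
  by apply: mulr_gt0 => //; apply: mulr_gt0 => //; apply: mulr_gt0.
have P0 : 0 <= P.
  by apply: Rintegral_ge0 => x rx; rewrite mulr_ge0 ?powR_ge0// ltW.
(* The supremum [M] may not be attained and level 0 may not be reached, so the run goes from a value
   near [M] to a level near 0. Each end costs less than [eta] by continuity of [phi]; doubled, the
   loss is below [4 eta], half of the supposed gap [L - S]. *)
have key (t : R) : 0 < t -> 2 * (mu `^ al * theta * J) <= t `^ p / p * P + t `^ (- q) / q * Q.
  move=> t0; set S := (X in _ <= X); rewrite leNgt; apply/negP => SL.
  set L := 2 * _ in SL L0.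
  pose eta := (L - S) / 8.
  have eta0 : 0 < eta by rewrite divr_gt0// subr_gt0.
  have [d1 d10 H1] := (continuous_epsP phi M).1 (phi_c M) eta eta0.
  have [d2 d20 H2] := (continuous_epsP phi 0).1 (phi_c 0) eta eta0.
  have dM : 0 < Num.min d1 M by rewrite lt_min d10.
  have [_ [x0 _ <-] x0M] := sup_adherent dM hs; rewrite -/M in x0M.
  have rx0 : 0 < rho x0.
    by apply: le_lt_trans x0M; rewrite subr_ge0 ge_min lexx orbT.
  have x0M' : M - d1 < rho x0.
    by apply: le_lt_trans x0M; rewrite lerD2l lerN2 ge_min lexx.
  pose e := Num.min (d2 / 2) (rho x0 / 2).
  have e0 : 0 < e by rewrite lt_min !divr_gt0.
  have ex0 : e < rho x0 by rewrite gt_min; apply/orP; right; lra.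
  have ed2 : e < d2 by rewrite gt_min; apply/orP; left; lra.
  have g0 (x : R) : 0 < rho x -> 0 <= g (rho x) by move=> _; exact: gfun_ge0.
  have HS := young_variation dphi g_c g0 gi t0 e0 ex0.
  have {}HS : 2 * (phi (rho x0) - phi e) <= S.
    apply: le_trans HS _; rewrite lerD2l ler_wpM2l//.
    by rewrite divr_ge0 ?powR_ge0 ?(ltW q0).
  have phiM : phi M = mu `^ al * theta * Phi lam0 p1 theta0 (vmax lam theta).
    by rewrite /phi muM (max_idPl (ltW ym0)).
  have phi0 : phi 0 = mu `^ al * theta * Phi lam0 p1 theta0 0.
    by rewrite /phi mulr0 maxxx powR0// gt_eqF.
  have LE : L = 2 * (phi M - phi 0) by rewrite phiM phi0 /L /J /Jphi; ring.
  have n1 : `|rho x0 - M| < d1.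
    by rewrite ltr_norml; apply/andP; split; have := rM x0; lra.
  have n2 : `|e - 0| < d2 by rewrite subr0 gtr0_norm.
  have := H1 _ n1; have := H2 _ n2; rewrite !ltr_norml.
  move=> /andP[_ h2] /andP[h1 _].
  have : eta * 8 = L - S by rewrite /eta divfK.
  by move: h1 h2 HS LE; lra.
have main := young_optimal p1 L0 P0 Q0 key.
(* As [k / q = al], the factor [y^(-k)] yields [mu^al], which cancels against the left-hand side of
   [main], and [exp(al * H)], which completes [exp(H / q)] to [exp(beta * H)]. *)
have QE : Q `^ q^-1 = mu `^ al * (expR (beta * H) * peak lam k `^ q^-1).
  have yk0 : 0 <= y `^ (- k) := powR_ge0 _ _.
  rewrite /Q (powRM _ (expR_ge0 H) (mulr_ge0 yk0 (ltW pk0))) (powRM _ yk0 (ltW pk0)).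
  rewrite -[(y `^ _) `^ _]powRrM.
  have -> : - k * q^-1 = - al by field; rewrite !gt_eqF.
  rewrite /y (powRM _ (ltW mi) (expR_ge0 (- H))).
  rewrite -[mu^-1]powR_inv1 ?(ltW mu0)// -powRrM mulN1r opprK -!expRM.
  have -> : expR (beta * H) = expR (H / q) * expR (- H * - al).
    by rewrite -expRD; congr expR; rewrite {1}betaE; ring.
  by ring.
have pkq : 0 < peak lam k `^ q^-1 by rewrite powR_gt0.
rewrite complexityE -/P -/H ler_pXn2r//; last 2 first.
- rewrite nnegrE; apply: divr_ge0; last exact: ltW.
  by apply: mulr_ge0; [apply: mulr_ge0 => //; exact: ltW|exact: ltW].
- by rewrite nnegrE mulr_ge0 ?powR_ge0 ?expR_ge0.
rewrite ler_pdivrMr// -(ler_pM2l mal).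
move: main; rewrite QE.
have -> : 2 * (mu `^ al * theta * J) = mu `^ al * (2 * theta * J) by ring.
by move=> /le_trans; apply; rewrite le_eqVlt; apply/orP; left; apply/eqP; ring.
Qed.

End Admissible.

End LowerBound.

(** * Profiles and equality *)

Local Opaque pfun gfun powR vartheta conj_exp.

Section Profile.
Context {R : realType}.
Variables (p beta lam : R).
Hypotheses (p1 : 1 < p) (hD : Dp p (beta, lam)).
Local Notation leb := (@lebesgue_measure R).
Implicit Types (x y z v e r s t : R).
Local Notation q := (conj_exp p).
Local Notation theta := (vartheta p beta).
Local Notation al := (theta^-1).
Local Notation k := (q / theta).
Local Notation pf := (pfun lam theta).
Local Notation vm := (vmax lam theta).

Let lam0 : 0 < lam := lam_gt0 hD.
Let theta0 : 0 < theta := theta_gt0 p1 hD.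
Local Notation J := (Jphi lam0 p1 theta0).

(* The bell-shaped solutions of the first integral [|u'|^p = kap^p pf(u)]. *)
Record profile (kap x0 : R) (u : R -> R) : Prop := Profile {
  profile_ge0 : forall x, 0 <= u x ;
  profile_top : u x0 = vm ;
  profile_lt : forall x, x != x0 -> u x < vm ;
  profile_left : forall x, x <= x0 -> is_derive x 1 u (kap * pf (u x) `^ p^-1) ;
  profile_right : forall x, x0 <= x -> is_derive x 1 u (- (kap * pf (u x) `^ p^-1)) ;
  profile_lim : forall e, 0 < e -> exists r, forall x, r < `|x| -> u x < e }.

Lemma profile_opp kap x0 u : profile kap x0 u -> profile kap (- x0) (fun x => u (- x)).
Proof.
case=> u0 ux0 ult ul ur ulim; split.
- by move=> x; exact: u0.
- by rewrite opprK.
- by move=> x xx0; apply: ult; rewrite eqr_oppLR.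
- move=> x xx0; have H := ur (- x); rewrite lerNr in H.
  apply: is_derive_eq (@is_derive_compfun _ u -%R _ _ _ (H xx0) (is_derive_oppfun x)) _.
  by rewrite mulrN1 opprK.
- move=> x xx0; have H := ul (- x); rewrite lerNl in H.
  apply: is_derive_eq (@is_derive_compfun _ u -%R _ _ _ (H xx0) (is_derive_oppfun x)) _.
  by rewrite mulrN1.
- by move=> e /ulim[r H]; exists r => x rx; apply: H; rewrite normrN.
Qed.

(** Shifts and dilations only change [x0] and [kap], so results on an arbitrary profile already
    cover the whole family. *)
Lemma profile_affine kap x0 u (x1 sigma : R) : 0 < sigma -> profile kap x0 u ->
  profile (kap / sigma) (x1 + sigma * x0) (fun x => u ((x - x1) / sigma)).
Proof.
move=> s0 [u0 ux0 ult ul ur ulim].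
have sn : sigma != 0 by rewrite gt_eqF.
have daff (x : R) : is_derive x 1 (fun x : R => (x - x1) / sigma) sigma^-1.
  have H := is_deriveMfun (is_deriveDfun (is_derive_idfun x) (is_derive_cstfun (- x1) x))
    (is_derive_cstfun sigma^-1 x).
  by apply: is_derive_eq H _; rewrite mulr0 addr0 mul1r add0r.
split.
- by move=> x; exact: u0.
- by rewrite addrAC subrr add0r mulrAC mulfV// mul1r.
- move=> x xx; apply: ult; apply: contra xx => /eqP <-; apply/eqP.
  by field.
- move=> x xx; have H : (x - x1) / sigma <= x0 by rewrite ler_pdivrMr// mulrC; lra.
  apply: is_derive_eq (@is_derive_compfun _ u (fun x => (x - x1) / sigma) _ _ _ (ul _ H) (daff x)) _.
  by rewrite mulrAC.
- move=> x xx; have H : x0 <= (x - x1) / sigma by rewrite ler_pdivlMr// mulrC; lra.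
  apply: is_derive_eq (@is_derive_compfun _ u (fun x => (x - x1) / sigma) _ _ _ (ur _ H) (daff x)) _.
  by rewrite mulNr mulrAC.
- move=> e /ulim[r H]; exists (sigma * `|r| + `|x1|) => x rx; apply: H.
  rewrite normrM normfV (gtr0_norm s0) ltr_pdivlMr//.
  have := ler_normB x x1; have := ler_norm r.
  have : `|x| <= `|x - x1| + `|x1| by rewrite -{1}[x](subrK x1) ler_normD.
  by move=> h1 h2 _; have := ler_wpM2l (ltW s0) h2; rewrite [r * _]mulrC; lra.
Qed.

Section Integrals.
Variables (kap x0 : R) (u : R -> R).
Hypotheses (kap0 : 0 < kap) (uP : profile kap x0 u).

Lemma profile_le x : u x <= vm.
Proof.
have [->|xx0] := eqVneq x x0; first by rewrite (profile_top uP).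
by rewrite ltW// (profile_lt uP).
Qed.

Lemma profile_continuous x : {for x, continuous u}.
Proof.
have [xx0|/ltW xx0] := leP x x0; first exact: is_derive_continuous (profile_left uP xx0).
exact: is_derive_continuous (profile_right uP xx0).
Qed.

(** Along [u' = - kap * pf(u)^(1/p)], the function [- Lam(u) / kap] is an antiderivative of [h(u)];
    it runs from [u = vm] at [x0] to [u = 0] at infinity. [Lam] need not be differentiable at [vm],
    so at [x0] only continuity is used. *)
Lemma profile_right_integral (h Lam : R -> R) :
  (forall v, {for v, continuous h}) -> (forall v, {for v, continuous Lam}) ->
  (forall v, 0 <= v -> v <= vm -> 0 <= h v) ->
  (forall v, 0 <= v -> v < vm ->
     exists2 d : R, is_derive v 1 Lam d & d * pf v `^ p^-1 = h v) ->
  (\int[leb]_(x in `[x0, +oo[) (h (u x))%:E = ((Lam vm - Lam 0) / kap)%:E)%E.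
Proof.
move=> hc Lc h0 dL; pose F x := - (kap^-1 * Lam (u x)).
have Fc x : {for x, continuous F}.
  apply: continuousNfun; apply: continuousZfun.
  by apply: continuous_compfun; [exact: profile_continuous|exact: Lc].
have huc x : {for x, continuous (fun x => h (u x))}.
  by apply: continuous_compfun; [exact: profile_continuous|exact: hc].
have dF x : x0 < x -> is_derive x 1 F (h (u x)).
  move=> xx0; have [||d dd dh] := dL (u x); first exact: (profile_ge0 uP).
    by apply: (profile_lt uP); rewrite gt_eqF.
  have H := is_deriveNfun (is_deriveZfun kap^-1
    (is_derive_compfun dd (profile_right uP (ltW xx0)))).
  apply: is_derive_eq H _; rewrite -dh.
  by field; rewrite gt_eqF.
rewrite (@ge0_continuous_FTC2y _ (fun x => h (u x)) F x0 (- (kap^-1 * Lam 0))).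
- rewrite /F (profile_top uP) -EFinB; congr EFin.
  by rewrite mulrBl; ring.
- by move=> x _; apply: h0; [exact: (profile_ge0 uP)|exact: profile_le].
- by apply: continuous_subspaceT => x; exact: huc.
- apply/cvgrPdist_lt => e e0.
  have ke0 : 0 < kap * e by rewrite mulr_gt0.
  have [d d0 H] := (continuous_epsP Lam 0).1 (Lc 0) _ ke0.
  have [r Hr] := profile_lim uP d0.
  exists (Num.max r 0); split; first by rewrite num_real.
  move=> x rx; rewrite /F opprK addrC -mulrBr normrM gtr0_norm ?invr_gt0//.
  rewrite ltr_pdivrMl//; apply: H; rewrite subr0 ger0_norm ?(profile_ge0 uP)//.
  apply: Hr; move: rx; rewrite gt_max => /andP[rx xp].
  by rewrite gtr0_norm.
- by move=> x /dF[].
- by apply: cvg_at_right_filter; exact: Fc.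
- by move=> x; rewrite in_itv/= andbT => /dF/is_derive_derive1.
Qed.

End Integrals.

Lemma profile_integral kap x0 u (h Lam : R -> R) : 0 < kap -> profile kap x0 u ->
  (forall v, {for v, continuous h}) -> (forall v, {for v, continuous Lam}) ->
  (forall v, 0 <= v -> v <= vm -> 0 <= h v) ->
  (forall v, 0 <= v -> v < vm ->
     exists2 d : R, is_derive v 1 Lam d & d * pf v `^ p^-1 = h v) ->
  (\int[leb]_x (h (u x))%:E = (2 * ((Lam vm - Lam 0) / kap))%:E)%E.
Proof.
move=> kap0 uP hc Lc h0 dL.
have huc x : {for x, continuous (fun x => h (u x))}.
  by apply: continuous_compfun; [exact: (profile_continuous uP)|exact: hc].
have hu0 x : 0 <= h (u x).
  by apply: h0; [exact: (profile_ge0 uP)|exact: (profile_le uP)].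
have mh : measurable_fun [set: R] (fun x => (h (u x))%:E).
  by apply/measurable_EFinP; apply: continuous_measurable_fun => x; exact: huc.
have right := profile_right_integral kap0 uP hc Lc h0 dL.
have left := profile_right_integral kap0 (profile_opp uP) hc Lc h0 dL.
have := @ge0_integration_by_substitutionNy R (fun x => h (u x)) (- x0).
rewrite opprK => sub; rewrite -[X in X = _]sub in left; last 2 first.
- by apply: continuous_subspaceT => x; exact: huc.
- by move=> x _; exact: hu0.
have -> : [set: R] = `]-oo, x0] `|` `]x0, +oo[.
  by apply/seteqP; split => // x _ /=; rewrite !in_itv/= andbT; case: leP; [left|right].
rewrite ge0_integral_setU//=.
- rewrite left integral_itv_obnd_cbnd ?right -?EFinD ?mulr_natl ?mulr2n//.
  exact: measurable_funTS.
- exact: measurable_funTS.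
- by move=> x _; rewrite lee_fin.
- apply/disj_set2P; rewrite -subset0 => x /= []; rewrite !in_itv/= andbT.
  by move=> h1 h2; move: (lt_le_trans h2 h1); rewrite ltxx.
Qed.

Section Equality.
Variables (kap x0 : R) (u : R -> R).
Hypotheses (kap0 : 0 < kap) (uP : profile kap x0 u).

Let q0 : 0 < q := conj_exp_gt0 p1.
Let p0 : 0 < p := lt_trans ltr01 p1.

Lemma profile_pot_integral :
  (\int[leb]_x (pot lam (u x `^ theta))%:E = (2 * (J / kap))%:E)%E.
Proof.
rewrite -(@profile_integral kap x0 u pf (Phi lam0 p1 theta0) kap0 uP).
- by apply: eq_integral => x _; rewrite pfunE// (profile_ge0 uP).
- by move=> v; exact: pfun_continuous.
- by move=> v; exact: is_derive_continuous (is_derive_Phi lam0 p1 theta0 v).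
- by move=> v _ vv; exact: pfun_ge0.
- move=> v _ vv; exists (gfun lam p theta v); first exact: is_derive_Phi.
  by apply: gfunM => //; exact: ltW.
Qed.

Lemma profile_mass :
  (\int[leb]_x (u x `^ theta)%:E = (2 * ((lam + k) * J / kap))%:E)%E.
Proof.
have -> : (lam + k) * J = Psi lam0 p1 theta0 vm - Psi lam0 p1 theta0 0.
  by rewrite Psi_vmax Psi0 /Jphi mulrBr.
rewrite -(@profile_integral kap x0 u (fun v => (Num.max v 0) `^ theta)
  (Psi lam0 p1 theta0) kap0 uP).
- by apply: eq_integral => x _; rewrite (max_idPl _)// (profile_ge0 uP).
- exact: powR_max0_continuous.
- by move=> v; exact: Psi_continuous.
- by move=> v _ _; exact: powR_ge0.
- by move=> v v0 vv; rewrite (max_idPl v0); exact: is_derive_Psi.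
Qed.

(** One formula for both sides: one of the two terms is always taken at [x0], where it vanishes.
    Continuity of the derivative then follows without a case at [x0]. *)
Lemma profile_derive1E x : derive1 u x =
  kap * pf (u (Num.min x x0)) `^ p^-1 - kap * pf (u (Num.max x x0)) `^ p^-1.
Proof.
have z : kap * pf (u x0) `^ p^-1 = 0.
  by rewrite (profile_top uP) pfun_vmax// powR0 ?mulr0// invr_eq0 gt_eqF.
have [xx0|xx0] := leP x x0.
  rewrite (is_derive_derive1 (profile_left uP xx0)).
  by rewrite [X in _ - X]z subr0.
rewrite (is_derive_derive1 (profile_right uP (ltW xx0))).
by rewrite [X in X - _]z sub0r.
Qed.

Lemma profile_C1 : continuous (derive1 u).
Proof.
have -> : derive1 u = (fun x => kap * pf (u (Num.min x x0)) `^ p^-1 -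
    kap * pf (u (Num.max x x0)) `^ p^-1) by apply/funext => x; exact: profile_derive1E.
have wc y : {for y, continuous (fun y => pf (u y) `^ p^-1)}.
  have -> : (fun y => pf (u y) `^ p^-1) = (fun y => (Num.max (pf (u y)) 0) `^ p^-1).
    by apply/funext => z; rewrite (max_idPl _)// pfun_ge0// (profile_le uP).
  apply: (@continuous_compfun _ (fun y => (Num.max y 0) `^ p^-1) (fun y => pf (u y))).
    by apply: continuous_compfun; [exact: (profile_continuous uP)|exact: pfun_continuous].
  by apply: powR_max0_continuous; rewrite invr_gt0.
have minc x : {for x, continuous (fun y => Num.min y x0)}.
  by apply: continuous_min; [exact: id|exact: cst_continuous].
have maxc x : {for x, continuous (fun y => Num.max y x0)}.
  by apply: continuous_max; [exact: id|exact: cst_continuous].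
have H1 x := continuousZfun (k := kap) (continuous_compfun (minc x) (wc _)).
have H2 x := continuousNfun (continuousZfun (k := kap) (continuous_compfun (maxc x) (wc _))).
by move=> x; exact: (continuousDfun (H1 x) (H2 x)).
Qed.

Lemma profile_derivable x : derivable u x 1.
Proof.
have [xx0|/ltW xx0] := leP x x0; first by have [] := profile_left uP xx0.
by have [] := profile_right uP xx0.
Qed.

Lemma profile_norm_derive1 x : `|derive1 u x| = kap * pf (u x) `^ p^-1.
Proof.
have [xx0|/ltW xx0] := leP x x0.
  rewrite (is_derive_derive1 (profile_left uP xx0)) ger0_norm//.
  by rewrite mulr_ge0 ?powR_ge0// ltW.
rewrite (is_derive_derive1 (profile_right uP xx0)) normrN ger0_norm//.
by rewrite mulr_ge0 ?powR_ge0// ltW.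
Qed.

Variable mu : R.
Hypothesis mu0 : 0 < mu.
Let rho (x : R) : R := mu * u x `^ theta.
Hypothesis rhoD : is_density rho.

Let rho_gt0 x : (0 < rho x) = (0 < u x).
Proof.
rewrite /rho pmulr_rgt0//; have := profile_ge0 uP x; rewrite le_eqVlt.
by move=> /predU1P[<-|ux]; rewrite ?powR0 ?ltxx ?gt_eqF// ux powR_gt0.
Qed.

(** At a zero of [u] the existence of the derivative rests on [1 <= theta]: for [theta > 1] by
    differentiating [|u|^theta], for [theta = 1] because [rho = mu * u]. *)
Let is_derive_rho x : exists2 d, is_derive x 1 rho d &
  0 < u x -> d = mu * (theta * u x `^ (theta - 1) * derive1 u x).
Proof.
have du : is_derive x 1 u (derive1 u x).
  by apply: derivable_is_derive; exact: profile_derivable.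
have := theta_ge1 p1 hD; rewrite le_eqVlt => /predU1P[t1|t1].
  exists (mu * derive1 u x).
    have -> : rho = (fun x => mu * u x).
      by apply/funext => y; rewrite /rho -t1 powRr1// (profile_ge0 uP).
    exact: is_deriveZfun.
  by move=> _; rewrite -t1 subrr powRr0 !mul1r.
exists (mu * (theta * (`|u x| `^ (theta - 2) * u x) * derive1 u x)).
  have -> : rho = (fun x => mu * (`|u x| `^ theta)).
    by apply/funext => y; rewrite /rho ger0_norm// (profile_ge0 uP).
  apply: is_deriveZfun.
  exact: (is_derive_compfun (is_derive_powR_norm (u x) t1) du).
move=> ux; rewrite gtr0_norm//; congr (_ * (_ * _ * _)).
have un : u x != 0 by rewrite gt_eqF.
rewrite -[X in _ * X](powRr1 (ltW ux)) -powRD ?un ?implybT//.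
by congr (_ `^ _); ring.
Qed.

Lemma profile_regular : regular rho.
Proof.
split=> x; first by have [d []] := is_derive_rho x.
rewrite rho_gt0 => ux.
pose f y := mu * (theta * u y `^ (theta - 1) * derive1 u y).
have fc : {for x, continuous f}.
  apply: continuousZfun; apply: continuousMfun; last exact: profile_C1.
  apply: continuousZfun.
  apply: (@continuous_compfun _ (fun v => v `^ (theta - 1)) u).
    exact: (profile_continuous uP).
  exact: is_derive_continuous (is_derive1_powR (theta - 1) ux).
have [d d0 H] := (continuous_epsP u x).1 (profile_continuous uP (x:=x)) _ ux.
have E y : `|y - x| < d -> derive1 rho y = f y.
  move=> /H; rewrite ltr_norml => /andP[uy _].
  have uy0 : 0 < u y by lra.
  by have [e de eE] := is_derive_rho y; rewrite (is_derive_derive1 de) eE.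
apply/continuous_epsP => e e0; have [d' d'0 H'] := (continuous_epsP f x).1 fc e e0.
exists (Num.min d d'); first by rewrite lt_min d0.
move=> y; rewrite lt_min => /andP[yd yd'].
by rewrite !E ?subrr ?normr0//; exact: H'.
Qed.

Let c := mu `^ al * theta * kap.

(** In [|rho'| rho^(al - 1)] the powers of [u] cancel, as [theta - 1 + theta * (al - 1) = 0]; what
    is left is [c * pf(u)^(1/p)]. *)
Lemma profile_fisherE x : 0 < rho x ->
  fisher_integrand p beta rho x = c `^ p * pot lam (u x `^ theta).
Proof.
move=> rx; have ux : 0 < u x by rewrite -rho_gt0.
have un : u x != 0 by rewrite gt_eqF.
have mun : mu != 0 by rewrite gt_eqF.
rewrite (fisher_integrandE p1 hD)//; last by case: profile_regular.
have [d dd dE] := is_derive_rho x.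
have n0 : 0 <= theta * u x `^ (theta - 1).
  by apply: mulr_ge0; [exact: ltW|exact: powR_ge0].
rewrite (is_derive_derive1 dd) dE// normrM (gtr0_norm mu0) normrM (ger0_norm n0).
rewrite profile_norm_derive1.
rewrite /rho (powRM _ (ltW mu0) (powR_ge0 _ _)) -[(_ `^ theta) `^ _]powRrM.
have W0 : 0 <= pf (u x) by rewrite pfun_ge0// (profile_le uP).
have Wp : (pf (u x) `^ p^-1) `^ p = pf (u x).
  by rewrite -powRrM (mulVf (lt0r_neq0 p0)) (powRr1 W0).
rewrite -(pfunE lam theta (ltW ux)) -[in RHS]Wp.
have c0 : 0 <= c.
  by apply: mulr_ge0; [apply: mulr_ge0; [exact: powR_ge0|exact: ltW]|exact: ltW].
rewrite -(powRM _ c0 (powR_ge0 _ _)); congr (_ `^ _).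
have u1 : u x `^ (theta - 1) * u x `^ (theta * (al - 1)) = 1.
  rewrite -powRD ?un ?implybT//.
  have -> : theta - 1 + theta * (al - 1) = 0 by field; rewrite gt_eqF.
  by rewrite powRr0.
have m1 : mu * mu `^ (al - 1) = mu `^ al.
  by rewrite mulr_powRB1 ?(ltW mu0)// invr_gt0.
rewrite /c -m1.
transitivity (u x `^ (theta - 1) * u x `^ (theta * (al - 1)) *
  (mu * mu `^ (al - 1) * theta * kap * pf (u x) `^ p^-1)); last by rewrite u1 mul1r.
by ring.
Qed.

Let y (x : R) : R := u x `^ theta.

Let rhoy x : mu^-1 * rho x = y x.
Proof. by rewrite /rho mulrA mulVf ?mul1r// gt_eqF. Qed.

Let y0 x : 0 <= y x. Proof. exact: powR_ge0. Qed.

Let y_cont : continuous y.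
Proof.
have -> : y = (fun x => (Num.max (u x) 0) `^ theta).
  by apply/funext => z; rewrite /y (max_idPl (profile_ge0 uP z)).
have H x : {for x, continuous (fun x => (Num.max (u x) 0) `^ theta)}.
  apply: (@continuous_compfun _ (fun v => (Num.max v 0) `^ theta) u).
    exact: (profile_continuous uP).
  exact: powR_max0_continuous.
exact: H.
Qed.

Let pot_y_cont : continuous (fun x => pot lam (y x)).
Proof.
have -> : (fun x => pot lam (y x)) = (fun x => pf (u x)).
  by apply/funext => x; rewrite pfunE// (profile_ge0 uP).
have H x : {for x, continuous (fun x => pf (u x))}.
  by apply: continuous_compfun; [exact: (profile_continuous uP)|exact: pfun_continuous].
exact: H.
Qed.

Let pot_y_ge0 x : 0 <= pot lam (y x).
Proof. by rewrite -pfunE ?(profile_ge0 uP)// pfun_ge0// (profile_le uP). Qed.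

Let ge0_integrable (f : R -> R) (s : R) : continuous f -> (forall x, 0 <= f x) ->
  (\int[leb]_x (f x)%:E = s%:E)%E ->
  leb.-integrable [set: R] (EFin \o f) /\ \int[leb]_x f x = s.
Proof.
move=> fc f0 fs; split; last by rewrite /Rintegral fs.
apply/integrableP; split; first by apply/measurable_EFinP; exact: continuous_measurable_fun.
have -> : (\int[leb]_x `|(EFin \o f) x| = \int[leb]_x (f x)%:E)%E.
  by apply: eq_integral => x _; rewrite /= ger0_norm.
by rewrite fs ltry.
Qed.

Let pot_int := ge0_integrable pot_y_cont pot_y_ge0 profile_pot_integral.
Let y_int := ge0_integrable y_cont y0 profile_mass.

Let ell_int : leb.-integrable [set: R] (EFin \o (fun x => y x * ell lam (y x))) /\
  \int[leb]_x (y x * ell lam (y x)) = - (2 * (k * J / kap)).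
Proof.
have [i1 I1] := pot_int; have [i2 I2] := y_int.
have E x : lam * pot lam (y x) + -1 * y x = y x * ell lam (y x).
  by rewrite /pot; field; rewrite gt_eqF.
have j1 := integrableZfun lam measurableT i1.
have j2 := integrableZfun (-1) measurableT i2.
split.
  by apply: (@eq_integrable_fun _ _ _ _ measurableT _ (integrableDfun measurableT j1 j2)) => x _.
rewrite -(eq_Rintegral_fun (fun x _ => E x)) RintegralD// !RintegralZl// I1 I2.
by move: J => j; ring.
Qed.

Lemma profile_renyi_integrable :
  leb.-integrable [set: R] (EFin \o renyi_integrand lam rho).
Proof.
have [i1 _] := y_int; have [i2 _] := ell_int.
have [l1|l1] := eqVneq lam 1.
  have l1b : (lam == 1) = true by rewrite l1 eqxx.
  have j1 := integrableZfun (mu * ln mu) measurableT i1.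
  have j2 := integrableZfun (- mu) measurableT i2.
  apply: (@eq_integrable_fun _ _ _ _ measurableT _ (integrableDfun measurableT j1 j2)) => x _.
  rewrite /renyi_integrand /ell l1b /rho -/(y x).
  have := y0 x; rewrite le_eqVlt => /predU1P[<-|yx].
    by rewrite !(mul0r, mulr0) addr0.
  by rewrite lnM ?posrE//; ring.
have l1' : 1 - lam != 0 by rewrite subr_eq0 eq_sym.
have j1 := integrableZfun (mu `^ lam) measurableT i1.
have j2 := integrableZfun (mu `^ lam * (1 - lam)) measurableT i2.
apply: (@eq_integrable_fun _ _ _ _ measurableT _ (integrableDfun measurableT j1 j2)) => x _.
rewrite /renyi_integrand /ell (negPf l1) /rho -/(y x) (powRM _ (ltW mu0) (y0 x)).
by rewrite -(mulr_powRB1 (y0 x) lam0); field.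
Qed.

Lemma profile_admissible : admissible p beta lam rho.
Proof.
split=> //; first exact: profile_regular.
split; last exact: profile_renyi_integrable.
have mP : measurable (posset rho).
  apply: measurable_posset => x; case: profile_regular => dr _.
  exact: is_derive_continuous (derivable_is_derive (dr x)).
have [i1 _] := pot_int.
have i1' : leb.-integrable (posset rho) (EFin \o (fun x => pot lam (y x))).
  exact: integrableS i1.
have i2 := integrableZfun (c `^ p) mP i1'.
by apply: (@eq_integrable_fun _ _ _ _ mP _ i2) => x rx; rewrite profile_fisherE.
Qed.

(** Dividing [ell_int] by the mass gives [ell Y = - k / (lam + k)] for [Y = exp(- H) / mu], so [Y]
    is [ypeak] and [pot_le_peak] is an equality at [Y]. Then [mu], [H] and [kap] cancel out of the
    complexity. *)
Lemma profile_complexity :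
  complexity p beta lam rho = (2 * theta * J / peak lam k `^ q^-1) ^+ 2.
Proof.
have k0 : 0 < k by rewrite divr_gt0.
have J0 : 0 < J by exact: Jphi_gt0.
have lk0 : 0 < lam + k by rewrite addr_gt0.
have [pi pI] := pot_int; have [yi yI] := y_int; have [ei eI] := ell_int.
have mi : 0 < mu^-1 by rewrite invr_gt0.
have mun : mu != 0 by rewrite gt_eqF.
set H := renyi_entropy lam rho; pose Y := mu^-1 * expR (- H).
have Y0 : 0 < Y by rewrite mulr_gt0 ?expR_gt0.
have mass : mu^-1 = 2 * ((lam + k) * J / kap).
  rewrite -yI -[\int[leb]_x y x](eq_Rintegral_fun (fun x _ => rhoy x)).
  have [ri rI] := density_integrable rhoD.
  by rewrite RintegralZl// rI mulr1.
have [_] := ell_integral hD rhoD profile_renyi_integrable mi.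
rewrite -/H -/Y (eq_Rintegral_fun (g := fun x => y x * ell lam (y x))); last first.
  by move=> x _; rewrite rhoy.
rewrite eI mass => ellY.
have {}ellY : ell lam Y = - (k / (lam + k)).
  apply: (mulfI (lt0r_neq0 (_ : 0 < 2 * ((lam + k) * J / kap)))).
    by rewrite -mass.
  have idn (K j : R) : 0 < lam + K ->
      - (2 * (K * j / kap)) = 2 * ((lam + K) * j / kap) * - (K / (lam + K)).
    by move=> h; field; rewrite (lt0r_neq0 h) (lt0r_neq0 kap0).
  by rewrite -ellY; exact: idn.
have YE : Y = ypeak lam k.
  have yp := @ypeak_gt0 _ lam lam0 k k0; have ye := @ell_ypeak _ lam lam0 k k0.
  have [YY|YY|//] := ltgtP Y (ypeak lam k).
    by have := ell_decr lam Y0 YY; rewrite ellY ye ltxx.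
  by have := ell_decr lam yp YY; rewrite ellY ye ltxx.
have [_] := pot_integral hD rhoD profile_renyi_integrable mi.
rewrite -/H -/Y (eq_Rintegral_fun (g := fun x => pot lam (y x))); last first.
  by move=> x _; rewrite rhoy.
rewrite pI => potY.
set A := 2 * (J / kap) in potY pI.
have A0 : 0 < A by apply: mulr_gt0 => //; exact: divr_gt0.
have PE : \int[leb]_(x in posset rho) fisher_integrand p beta rho x = c `^ p * A.
  rewrite (eq_Rintegral_fun (g := fun x => c `^ p * pot lam (y x))); last first.
    by move=> x rx; rewrite profile_fisherE.
  rewrite -pI -RintegralZl// Rintegral_mkcond; apply: eq_Rintegral_fun => x _.
  rewrite patchE; case: ifPn => // /negP; rewrite inE /posset /= rho_gt0 => nux.
  have ux0 : u x = 0.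
    by apply/eqP; rewrite eq_le (profile_ge0 uP) andbT leNgt; exact/negP.
  by rewrite /y ux0 powR0 ?gt_eqF// pot0 mulr0.
have c0 : 0 < c.
  by apply: mulr_gt0 => //; apply: mulr_gt0 => //; exact: powR_gt0.
have PE' : (\int[leb]_(x in posset rho) fisher_integrand p beta rho x) `^ p^-1 =
    c * A `^ p^-1.
  rewrite PE (powRM _ (powR_ge0 _ _) (ltW A0)) -powRrM mulfV ?gt_eqF// powRr1//.
  exact: ltW.
have pk : peak lam k = Y `^ k * (expR (- H) * A).
  have potY' : pot lam Y = expR (- H) * A.
    by rewrite potY mulrA -expRD addNr expR0 mul1r.
  by rewrite /peak -YE potY'.
have pkq : peak lam k `^ q^-1 = mu `^ (- al) * expR (- (beta * H)) * A `^ q^-1.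
  rewrite pk (powRM _ (powR_ge0 _ _)); last by apply: mulr_ge0; [exact: expR_ge0|exact: ltW].
  rewrite (powRM _ (expR_ge0 _) (ltW A0)) -powRrM.
  have -> : k * q^-1 = al by field; rewrite !gt_eqF.
  rewrite /Y (powRM _ (ltW mi) (expR_ge0 _)) -[mu^-1]powR_inv1 ?(ltW mu0)//.
  rewrite -powRrM mulN1r -!expRM.
  have -> : expR (- (beta * H)) = expR (- H * al) * expR (- H / q).
    by rewrite -expRD; congr expR; rewrite {1}(betaE p1 hD); ring.
  by ring.
rewrite (complexityE p1 hD) -/H PE'; congr (_ ^+ 2).
have pk0 : 0 < peak lam k `^ q^-1 by rewrite powR_gt0// peak_gt0.
apply: (mulIf (lt0r_neq0 pk0)); rewrite divfK ?(lt0r_neq0 pk0)//.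
rewrite pkq /c.
have e1 : expR (beta * H) * expR (- (beta * H)) = 1 by rewrite -expRD subrr expR0.
have m1 : mu `^ al * mu `^ (- al) = 1.
  by rewrite powRN mulfV// gt_eqF// powR_gt0.
have A1 : A `^ p^-1 * A `^ q^-1 = A by rewrite mulrC powR_conjD// ltW.
transitivity ((mu `^ al * mu `^ (- al)) * (expR (beta * H) * expR (- (beta * H))) *
  (A `^ p^-1 * A `^ q^-1) * theta * kap).
  by ring.
have kn := lt0r_neq0 kap0.
by rewrite e1 m1 A1 /A; field; rewrite ?kn.
Qed.

End Equality.

End Profile.

(** * Solutions are profiles *)

Section SolutionProfile.
Context {R : realType}.
Variables (p beta lam : R).
Hypotheses (p1 : 1 < p) (hD : Dp p (beta, lam)).
Local Notation q := (conj_exp p).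
Local Notation theta := (vartheta p beta).
Local Notation pf := (pfun lam theta).
Local Notation vm := (vmax lam theta).
Implicit Types (x y z v e r s t : R).

Let lam0 : 0 < lam := lam_gt0 hD.
Let theta0 : 0 < theta := theta_gt0 p1 hD.
Let q0 : 0 < q := conj_exp_gt0 p1.
Let p0 : 0 < p := lt_trans ltr01 p1.
Let vm0 : 0 < vm := vmax_gt0 theta lam0.

Definition dpfun v := ell lam (v `^ theta) * (theta * v `^ (theta - 1)).

(** [dpfun] is the derivative of [pfun], so the equation says that the flux has derivative a
    constant times [pfun'(u)], the form that admits an energy. *)
Lemma reactionE gam v : 0 < v -> reaction theta gam lam v = gam / theta ^+ 2 * dpfun v.
Proof.
move=> v0; have tn : theta != 0 by rewrite gt_eqF.
rewrite /reaction /dpfun /ell; case: eqVneq => [l1|l1].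
  rewrite /reaction_eq1 ln_powR; move: (v `^ (theta - 1)) (ln v) => a b.
  by field.
have l1' : 1 - lam != 0 by rewrite subr_eq0 eq_sym.
have vn : v != 0 by rewrite gt_eqF.
rewrite /reaction_neq1 -powRrM.
have -> : v `^ (lam * theta - 1) = v `^ (theta * (lam - 1)) * v `^ (theta - 1).
  by rewrite -powRD ?vn ?implybT//; congr (_ `^ _); ring.
move: (v `^ (theta * (lam - 1))) (v `^ (theta - 1)) => a b.
by field; rewrite tn l1'.
Qed.

Lemma pfun_lt0 v : vm < v -> pf v < 0.
Proof.
move=> vv; have v0 : 0 < v by exact: lt_trans vv.
have yv : ymax lam < v `^ theta.
  by rewrite -(vmaxE lam0 theta0) gt0_ltr_powR// nnegrE ltW.
have := ell_decr lam (ymax_gt0 lam0) yv; rewrite (ell_ymax lam0) => l.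
rewrite pfunE ?(ltW v0)// /pot pmulr_llt0 ?invr_gt0// pmulr_rlt0; first lra.
exact: powR_gt0.
Qed.

(** Because [(p - 1) * (q - 1) = 1]. It recovers [u'] from the flux when the energy is
    differentiated. *)
Lemma flux_inv (d : R) (f := `|d| `^ (p - 2) * d) : `|f| `^ (q - 2) * f = d.
Proof.
have [d0|d0] := eqVneq d 0; first by rewrite /f d0 !mulr0.
have nd : 0 < `|d| by rewrite normr_gt0.
have ndn : `|d| != 0 by rewrite gt_eqF.
have -> : `|f| = `|d| `^ (p - 1).
  rewrite /f normrM ger0_norm ?powR_ge0//.
  rewrite -[X in _ * X](powRr1 (normr_ge0 d)) -powRD ?ndn ?implybT//.
  by congr (_ `^ _); ring.
rewrite /f mulrA -powRrM -powRD ?ndn ?implybT//.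
have -> : (p - 1) * (q - 2) + (p - 2) = 0.
  by have pn : p - 1 != 0 by [rewrite subr_eq0 gt_eqF]; rewrite conj_expE; field.
by rewrite powRr0 mul1r.
Qed.

Lemma flux_norm (d : R) (f := `|d| `^ (p - 2) * d) : `|f| `^ q = `|d| `^ p.
Proof.
have [d0|d0] := eqVneq d 0.
  by rewrite /f d0 mulr0 normr0 !powR0 ?gt_eqF.
have nd : 0 < `|d| by rewrite normr_gt0.
have ndn : `|d| != 0 by rewrite gt_eqF.
have -> : `|f| = `|d| `^ (p - 1).
  rewrite /f normrM ger0_norm ?powR_ge0//.
  rewrite -[X in _ * X](powRr1 (normr_ge0 d)) -powRD ?ndn ?implybT//.
  by congr (_ `^ _); ring.
rewrite -powRrM; congr (_ `^ _).
by have pn : p - 1 != 0 by [rewrite subr_eq0 gt_eqF]; rewrite conj_expE; field.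
Qed.

Variables (gam : R) (u : R -> R).
Hypothesis uS : is_solution p beta lam gam u.
Hypothesis uD : is_density (fun x => u x `^ theta).

Let u0 x : 0 <= u x. Proof. by case: uS. Qed.
Let du x : is_derive x 1 u (derive1 u x).
Proof. by apply: derivable_is_derive; case: uS. Qed.
Let uc x : {for x, continuous u}. Proof. exact: is_derive_continuous (du x). Qed.
Let duc x : {for x, continuous (derive1 u)}. Proof. by case: uS => _ _ + _ _; exact. Qed.
Let upos a b x : 0 < u a -> 0 < u b -> a <= x <= b -> 0 < u x.
Proof. by case: uS => _ _ _ + _ ua ub axb; move=> /(_ a b ua ub x axb). Qed.
Let g2 := gam / theta ^+ 2.
Let fl := pflux p u.

Let dfl x : 0 < u x -> is_derive x 1 fl (g2 * dpfun (u x)).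
Proof.
move=> ux; case: uS => _ _ _ _ /(_ x ux)[dd E].
apply: is_derive_eq (derivable_is_derive dd) _; apply/eqP.
by rewrite -reactionE// eq_sym -subr_eq0 addrC E.
Qed.

Lemma min_derive1 (f : R -> R) a b c : (forall x, is_derive x 1 f (derive1 f x)) ->
  a < c < b -> (forall x, a < x < b -> f c <= f x) -> derive1 f c = 0.
Proof.
move=> df /andP[ac cb] fmin; apply: is_derive_derive1.
apply: (@derive1_at_min _ f a b c).
- by rewrite ltW// (lt_trans ac).
- by move=> t _; case: (df t).
- by rewrite in_itv/= ac.
- by move=> t; rewrite in_itv/=; exact: fmin.
Qed.

Lemma zero_derive1 x : u x = 0 -> derive1 u x = 0.
Proof.
move=> ux; apply: (@min_derive1 u (x - 1) (x + 1)) => //; first by apply/andP; split; lra.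
by move=> y _; rewrite ux.
Qed.

(* The energy of the equation, written with the flux because the flux, unlike
   [derive1 u], is differentiable where [u > 0]. *)
Let en x := q^-1 * `|fl x| `^ q - g2 * pf (u x).

Let enE x : en x = q^-1 * `|derive1 u x| `^ p - g2 * pf (u x).
Proof. by rewrite /en /fl /pflux flux_norm. Qed.

Let d_en x : 0 < u x -> is_derive x 1 en 0.
Proof.
move=> ux; have q1 := conj_exp_gt1 p1.
have h1 := @is_derive_compfun _ (fun y => `|y| `^ q) fl x _ _
  (is_derive_powR_norm (fl x) q1) (dfl ux).
have h2 := @is_derive_compfun _ pf u x _ _ (is_derive_pfun theta lam0 ux) (du x).
have H := is_deriveDfun (is_deriveZfun q^-1 h1) (is_deriveNfun (is_deriveZfun g2 h2)).
apply: is_derive_eq H _; rewrite -/(dpfun (u x)) {2}/fl /pflux flux_inv.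
by move: (dpfun _) (derive1 u x) g2 => a b c; field; rewrite gt_eqF.
Qed.

Lemma energy_const x y : 0 < u x -> 0 < u y -> en x = en y.
Proof.
wlog xy : x y / x < y.
  move=> H ux uy; have [xy|xy|->//] := ltgtP x y; first exact: H.
  by apply/esym/H.
move=> ux uy; have P z : x <= z <= y -> 0 < u z by exact: upos.
have [||c _ E] := @mean_value _ en (fun=> 0) x y xy.
- by move=> z /andP[xz zy]; apply: d_en; apply: P; rewrite !ltW.
- by move=> z zxy; exact: is_derive_continuous (d_en (P z zxy)).
by apply/esym/eqP; rewrite -subr_eq0 E mul0r.
Qed.

Let upos_ex : exists x, 0 < u x.
Proof.
have [x ux] := density_pos uD; exists x.
by rewrite lt_neqAle u0 andbT eq_sym; apply: contraTneq ux => ->; rewrite powR0 ?ltxx ?gt_eqF.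
Qed.

Let small_right x0 e : 0 < e -> exists2 x, x0 < x & u x < e.
Proof.
move=> e0; have [x xx ux] := density_small_right x0 uD (powR_gt0 theta e0).
exists x => //; rewrite ltNge; apply: contraTN ux => eu; rewrite -leNgt.
by apply: ge0_ler_powR; rewrite ?nnegrE ?(ltW theta0) ?(ltW e0).
Qed.

Let small_left x0 e : 0 < e -> exists2 x, x < x0 & u x < e.
Proof.
move=> e0; have [x xx ux] := density_small_left x0 uD (powR_gt0 theta e0).
exists x => //; rewrite ltNge; apply: contraTN ux => eu; rewrite -leNgt.
by apply: ge0_ler_powR; rewrite ?nnegrE ?(ltW theta0) ?(ltW e0).
Qed.

(* If [u] vanishes somewhere, look near an end point of its support; otherwise
   perturb [u] by a small parabola centered at a point where [u] is small. *)
Lemma small_point e : 0 < e -> exists x, [/\ 0 < u x, u x < e & `|derive1 u x| < e].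
Proof.
move=> e0; have [x0 ux0] := upos_ex.
have near0 b : u b = 0 -> exists2 d : R, 0 < d &
    forall x, `|x - b| < d -> u x < e /\ `|derive1 u x| < e.
  move=> ub; have [d1 d10 H1] := (continuous_epsP u b).1 (@uc b) e e0.
  have [d2 d20 H2] := (continuous_epsP _ b).1 (@duc b) e e0.
  exists (Num.min d1 d2); first by rewrite lt_min d10.
  move=> x; rewrite lt_min => /andP[/H1 + /H2].
  by rewrite ub (zero_derive1 ub) !subr0 ger0_norm.
have [[z uz]|nz] := pselect (exists z, u z = 0).
  have uz0 : u z <= 0 by rewrite uz.
  have [xz|xz|xz] := ltgtP x0 z; last by move: ux0; rewrite xz uz ltxx.
    have [b [/andP[xb _] ub above]] := level_right uc (ltW xz) ux0 uz0.
    have [d d0 H] := near0 b ub.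
    have m0 : 0 < Num.min d (b - x0) by rewrite lt_min d0 subr_gt0.
    have md : Num.min d (b - x0) <= d by rewrite ge_min lexx.
    have mb : Num.min d (b - x0) <= b - x0 by rewrite ge_min lexx orbT.
    exists (b - Num.min d (b - x0) / 2).
    have [|h1 h2] := H (b - Num.min d (b - x0) / 2).
      by rewrite ltr_norml; apply/andP; split; lra.
    by split => //; apply: above; apply/andP; split; lra.
  have [b [/andP[_ xb] ub above]] := level_left uc (ltW xz) ux0 uz0.
  have [d d0 H] := near0 b ub.
  have m0 : 0 < Num.min d (x0 - b) by rewrite lt_min d0 subr_gt0.
  have md : Num.min d (x0 - b) <= d by rewrite ge_min lexx.
  have mb : Num.min d (x0 - b) <= x0 - b by rewrite ge_min lexx orbT.
  exists (b + Num.min d (x0 - b) / 2).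
  have [|h1 h2] := H (b + Num.min d (x0 - b) / 2).
    by rewrite ltr_norml; apply/andP; split; lra.
  by split => //; apply: above; apply/andP; split; lra.
have up x : 0 < u x.
  by rewrite lt_neqAle u0 andbT eq_sym; apply/eqP => ux; apply: nz; exists x.
pose e' := e / 2.
have e'0 : 0 < e' by rewrite divr_gt0.
have [c _ uce] := small_right x0 e'0.
(* At [c - 1] and [c + 1] the parabola alone equals [e'], more than [psi c = u c], so the minimum
   [w] is interior. There [u w <= u c < e / 2] and [|u' w| = 2 * e' * |w - c| < e]. *)
pose psi x := u x + e' * ((x - c) * (x - c)).
have dpsi x : is_derive x 1 psi (derive1 u x + e' * (2 * (x - c))).
  have h := is_deriveDfun (is_derive_idfun x) (is_derive_cstfun (- c) x).
  have H := is_deriveDfun (du x) (is_deriveZfun e' (is_deriveMfun h h)).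
  by apply: is_derive_eq H _; rewrite addr0 mul1r mulr1; ring.
have psic x : {for x, continuous psi} by exact: is_derive_continuous (dpsi x).
have cc : c - 1 <= c + 1 by lra.
have [w] := EVT_min cc (continuous_itvcc (fun x _ => psic x)).
rewrite in_itv/= => /andP[w1 w2] wmin.
have wc : psi w <= u c.
  have := wmin c; rewrite in_itv/= /psi subrr mulr0 mulr0 addr0; apply.
  by apply/andP; split; lra.
have psiw : psi w = u w + e' * ((w - c) * (w - c)) by [].
have sq : 0 <= e' * ((w - c) * (w - c)) by rewrite mulr_ge0 ?(ltW e'0)// -expr2 sqr_ge0.
have wn1 : w != c - 1.
  apply/eqP => wE; have uw := u0 w; move: psiw; rewrite wE => psiw.
  by have : (c - 1 - c) * (c - 1 - c) = 1 :> R; [ring|rewrite wE in wc uw; nra].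
have wn2 : w != c + 1.
  apply/eqP => wE; have uw := u0 w; move: psiw; rewrite wE => psiw.
  by have : (c + 1 - c) * (c + 1 - c) = 1 :> R; [ring|rewrite wE in wc uw; nra].
have wlt1 : c - 1 < w by rewrite lt_neqAle eq_sym wn1.
have wlt2 : w < c + 1 by rewrite lt_neqAle wn2.
have dw : derive1 psi w = 0.
  apply: (@min_derive1 psi (c - 1) (c + 1)).
  - by move=> x; rewrite (is_derive_derive1 (dpsi x)).
  - by rewrite wlt1.
  - by move=> x /andP[x1 x2]; apply: wmin; rewrite in_itv/= !ltW.
rewrite (is_derive_derive1 (dpsi w)) in dw.
exists w; split => //; first by rewrite /e' in uce *; lra.
have -> : derive1 u w = e' * (- (2 * (w - c))) by lra.
rewrite normrM gtr0_norm// normrN normrM ger0_norm//.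
have : `|w - c| < 1 by rewrite ltr_norml; apply/andP; split; lra.
by rewrite /e'; move: (`|w - c|) => a a1; nra.
Qed.

Lemma first_integral x : 0 < u x -> `|derive1 u x| `^ p = q * g2 * pf (u x).
Proof.
move=> ux; suff : en x = 0.
  rewrite enE => /eqP; rewrite subr_eq0 => /eqP E.
  by rewrite -mulrA -E mulrA mulfV ?mul1r// gt_eqF.
apply/eqP; apply/negP => /negP C0.
have c0 : 0 < `|en x| / 2 by rewrite divr_gt0// normr_gt0.
have fc : {for 0, continuous (fun v => q^-1 * `|v| `^ p)}.
  by apply: continuousZfun; exact: powR_norm_continuous.
have gc : {for 0, continuous (fun v => g2 * pf v)}.
  by apply: continuousZfun; exact: pfun_continuous.
have [d1 d10 H1] := (continuous_epsP _ _).1 fc _ c0.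
have [d2 d20 H2] := (continuous_epsP _ _).1 gc _ c0.
have d0 : 0 < Num.min d1 d2 by rewrite lt_min d10.
have [w [uw]] := small_point d0; rewrite !lt_min => /andP[_ uw2] /andP[dw1 _].
have z1 : q^-1 * `|0 : R| `^ p = 0 by rewrite normr0 powR0 ?mulr0 ?gt_eqF.
have z2 : g2 * pf 0 = 0 by rewrite pfun_le0// mulr0.
have := H1 (derive1 u w); rewrite subr0 [X in _ - X]z1 subr0 => /(_ dw1) h1.
have := H2 (u w); rewrite subr0 [X in _ - X]z2 subr0 (ger0_norm (u0 w)) => /(_ uw2) h2.
have : `|en x| < `|en x|; last by rewrite ltxx.
rewrite [X in X < _](_ : _ = `|en w|); last by rewrite (energy_const ux uw).
rewrite enE; apply: le_lt_trans (ler_normB _ _) _.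
by move: h1 h2; lra.
Qed.

(** The first integral at a point with [0 < u < vm] gives [0 <= g2]. With [g2 = 0] it would make [u]
    constant on its connected support, whereas [small_point] provides two distinct positive
    values. *)
Lemma solution_g2_gt0 : 0 < g2.
Proof.
have [w [uw uwv _]] := small_point vm0.
have W0 : 0 < pf (u w) by exact: pfun_gt0.
have g0 : 0 <= g2.
  have := powR_ge0 (`|derive1 u w|) p; rewrite first_integral//.
  by rewrite pmulr_lge0// pmulr_rge0.
rewrite lt_neqAle g0 andbT eq_sym; apply/eqP => g20.
have du0 x : 0 < u x -> derive1 u x = 0.
  move=> ux; have := first_integral ux; rewrite g20 mulr0 mul0r => /powR_eq0_eq0.
  by move/normr0P/eqP.
have [w' [uw' uww' _]] := small_point uw.
have cst x y : x < y -> 0 < u x -> 0 < u y -> u x = u y.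
  move=> xy ux uy; have [||c /andP[xc cy] E] := @mean_value _ u (derive1 u) x y xy.
  - by move=> z _; exact: du.
  - by move=> z _; exact: uc.
  apply/esym/eqP; rewrite -subr_eq0 E du0 ?mul0r//.
  by apply: (upos ux uy); rewrite !ltW.
have [ww|ww|ww] := ltgtP w w'.
- by move: uww'; rewrite (cst w w')// ltxx.
- by move: uww'; rewrite (cst w' w)// ltxx.
- by move: uww'; rewrite ww ltxx.
Qed.

Let g20 := solution_g2_gt0.

Let qg : 0 < q * g2. Proof. exact: mulr_gt0. Qed.

(** Above [vm] the first integral would make [|u'|^p] negative. *)
Let u_le x : u x <= vm.
Proof.
have [ux|ux] := leP (u x) 0; first exact: le_trans ux (ltW vm0).
rewrite leNgt; apply/negP => /pfun_lt0 W.
have := powR_ge0 (`|derive1 u x|) p; rewrite first_integral//.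
by rewrite (pmulr_rge0 _ qg) leNgt W.
Qed.

Let kap := (q * g2) `^ p^-1.

Let kap0 : 0 < kap.
Proof. by rewrite powR_gt0// mulr_gt0. Qed.

Let norm_du x : `|derive1 u x| = kap * pf (u x) `^ p^-1.
Proof.
have [ux|ux] := leP (u x) 0.
  have ux0 : u x = 0 by apply/eqP; rewrite eq_le ux u0.
  by rewrite zero_derive1// ux0 pfun_le0// powR0 ?invr_eq0 ?gt_eqF// normr0 mulr0.
have W0 : 0 <= pf (u x) by apply: pfun_ge0 => //; exact: u_le.
rewrite -(powRr1 (normr_ge0 _)) -(mulfV (lt0r_neq0 p0)) powRrM first_integral//.
by rewrite (powRM _ (ltW qg) W0).
Qed.

Let crit x : 0 < u x -> derive1 u x = 0 -> u x = vm.
Proof.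
move=> ux dx; have := first_integral ux.
rewrite dx normr0 powR0 ?gt_eqF// => /esym/eqP; rewrite mulf_eq0 (gt_eqF qg)/=.
move=> /eqP W0; apply/eqP; rewrite eq_le u_le/= leNgt; apply/negP => uv.
by have := pfun_gt0 lam0 theta0 ux uv; rewrite W0 ltxx.
Qed.

Let top_du x : u x = vm -> derive1 u x = 0.
Proof.
move=> ux; apply/eqP; rewrite -normr_eq0 norm_du ux pfun_vmax//.
by rewrite powR0 ?mulr0// invr_eq0 gt_eqF.
Qed.

(** A minimum of [u] between two tops is a top itself, being critical, so [u = vm] on [[a, b]]. The
    flux then vanishes around the midpoint, while the second-order equation gives it a nonzero
    derivative there. *)
Let top_unique a b : a < b -> u a = vm -> u b = vm -> False.
Proof.
move=> ab ua ub.
have pos x : a <= x <= b -> 0 < u x by apply: upos; rewrite ?ua ?ub.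
have [c] := EVT_min (ltW ab) (continuous_itvcc (fun x _ => @uc x)).
rewrite in_itv/= => /andP[ac cb] cmin.
have ucv : u c = vm.
  have [->//|ca] := eqVneq c a; have [->//|cb'] := eqVneq c b.
  have ac' : a < c by rewrite lt_neqAle eq_sym ca.
  have cb'' : c < b by rewrite lt_neqAle cb'.
  apply: crit; first by apply: pos; rewrite ac.
  apply: (@min_derive1 u a b) => //; first by rewrite ac'.
  by move=> x /andP[x1 x2]; apply: cmin; rewrite in_itv/= !ltW.
have flat x : a <= x <= b -> u x = vm.
  by move=> xab; apply/eqP; rewrite eq_le u_le -ucv cmin.
pose m := (a + b) / 2.
have mE : m * 2 = a + b by rewrite /m divfK.
have um : u m = vm by apply: flat; apply/andP; split; lra.
have ba0 : 0 < (b - a) / 2 by rewrite divr_gt0// subr_gt0.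
have d0 : is_derive m 1 fl 0.
  apply: (is_derive_ball ba0 _ (is_derive_cstfun 0 m)) => x.
  rewrite ltr_norml => /andP[h1 h2]; rewrite /fl /pflux top_du ?mulr0//.
  by apply: flat; apply/andP; split; lra.
have um0 : 0 < u m by rewrite um.
have := is_derive_derive1 (dfl um0); rewrite (is_derive_derive1 d0) /dpfun um.
rewrite (vmaxE lam0 theta0) (ell_ymax lam0) => /esym/eqP.
have t0 := mulr_gt0 theta0 (powR_gt0 (theta - 1) vm0).
by rewrite mulN1r mulrN oppr_eq0 (gt_eqF (mulr_gt0 g20 t0)).
Qed.

Lemma solution_profile : exists k x0, 0 < k /\ profile p beta lam k x0 u.
Proof.
have [x1 ux1] := upos_ex.
(* At both ends [u] is below [u x1], so its maximum on [[zl, zr]] is interior, hence critical. *)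
have [zr x1r ur] := small_right x1 ux1; have [zl x1l ul] := small_left x1 ux1.
have lr : zl <= zr by lra.
have [x0] := EVT_max lr (continuous_itvcc (fun x _ => @uc x)).
rewrite in_itv/= => /andP[zlx xzr] xmax.
have ux0 : u x1 <= u x0 by apply: xmax; rewrite in_itv/= !ltW.
have ux0p : 0 < u x0 by lra.
have top : u x0 = vm.
  apply: crit => //; apply: is_derive_derive1.
  apply: (@derive1_at_max _ u zl zr x0) => //.
  - by move=> t _; case: (du t).
  - rewrite in_itv/=; apply/andP; split.
      by rewrite lt_neqAle zlx andbT; apply/eqP => E; rewrite E in ul; lra.
    by rewrite lt_neqAle xzr andbT; apply/eqP => E; rewrite -E in ur; lra.
  - by move=> t; rewrite in_itv/= => /andP[h1 h2]; apply: xmax; rewrite in_itv/= !ltW.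
have uniq x : x != x0 -> u x != vm.
  move=> xx0; apply/eqP => uxv; have [xx|xx|xx] := ltgtP x x0.
  - exact: top_unique xx uxv top.
  - exact: top_unique xx top uxv.
  - by move: xx0; rewrite xx eqxx.
have ult x : x != x0 -> u x < vm by move=> xx; rewrite lt_neqAle u_le uniq.
have dne x : 0 < u x -> x != x0 -> derive1 u x != 0.
  by move=> ux xx; apply: contra (uniq x xx) => /eqP dx; apply/eqP; exact: crit.
have dwc (a b : R) : {within `[a, b], continuous (derive1 u)}.
  by apply: continuous_itvcc => x _; exact: duc.
(* [u] climbs from [u x] to [vm], so [u'] is positive somewhere in between; if [u' x <= 0], it
   vanishes at a second critical point left of [x0]. *)
have signl x : 0 < u x -> x < x0 -> 0 < derive1 u x.
  move=> ux xx0; have xn : x != x0 by rewrite lt_eqF.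
  rewrite ltNge; apply/negP => dx.
  have [||c /andP[xc cx0] E] := @mean_value _ u (derive1 u) x x0 xx0.
  - by move=> z _; exact: du.
  - by move=> z _; exact: uc.
  have dc : 0 < derive1 u c.
    rewrite -(pmulr_lgt0 _ (_ : 0 < x0 - x)) ?subr_gt0// -E subr_gt0 top.
    exact: ult.
  have mm : Num.min (derive1 u x) (derive1 u c) <= 0 <= Num.max (derive1 u x) (derive1 u c).
    by rewrite ge_min le_max dx (ltW dc) orbT.
  have [d] := IVT (ltW xc) (dwc x c) mm; rewrite in_itv/= => /andP[xd dc'] d0.
  have ud : 0 < u d by apply: (upos ux ux0p); lra.
  by have := dne d ud; rewrite d0 eqxx lt_eqF; [move=> /(_ isT)|lra].
have signr x : 0 < u x -> x0 < x -> derive1 u x < 0.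
  move=> ux xx0; have xn : x != x0 by rewrite gt_eqF.
  rewrite ltNge; apply/negP => dx.
  have [||c /andP[xc cx0] E] := @mean_value _ u (derive1 u) x0 x xx0.
  - by move=> z _; exact: du.
  - by move=> z _; exact: uc.
  have dc : derive1 u c < 0.
    rewrite -(pmulr_llt0 _ (_ : 0 < x - x0)) ?subr_gt0// -E subr_lt0 top.
    exact: ult.
  have mm : Num.min (derive1 u c) (derive1 u x) <= 0 <= Num.max (derive1 u c) (derive1 u x).
    by rewrite ge_min le_max dx (ltW dc) orbT.
  have [d] := IVT (ltW cx0) (dwc c x) mm; rewrite in_itv/= => /andP[xd dc'] d0.
  have ud : 0 < u d by apply: (upos ux0p ux); lra.
  by have := dne d ud; rewrite d0 eqxx gt_eqF; [move=> /(_ isT)|lra].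
have d_zero x : ~~ (0 < u x) -> derive1 u x = 0.
  by rewrite -leNgt => ux; apply: zero_derive1; apply/eqP; rewrite eq_le ux u0.
have dl x : x <= x0 -> 0 <= derive1 u x.
  rewrite le_eqVlt => /predU1P[->|xx]; first by rewrite top_du.
  by have [ux|/d_zero ->//] := boolP (0 < u x); rewrite ltW// signl.
have dr x : x0 <= x -> derive1 u x <= 0.
  rewrite le_eqVlt => /predU1P[<-|xx]; first by rewrite top_du.
  by have [ux|/d_zero ->//] := boolP (0 < u x); rewrite ltW// signr.
exists kap, x0; split => //; split => //.
- by move=> x xx; apply: is_derive_eq (du x) _; rewrite -norm_du ger0_norm// dl.
- by move=> x xx; apply: is_derive_eq (du x) _; rewrite -norm_du ler0_norm ?opprK// dr.
- move=> e e0.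
  have [ar x0r uar] := small_right x0 e0; have [al x0l ual] := small_left x0 e0.
  exists (Num.max (`|ar|) (`|al|)) => x; rewrite gt_max => /andP[xr xl].
  have [xp|xn] := leP 0 x.
    rewrite (ger0_norm xp) in xr; have axr : ar < x by exact: le_lt_trans (ler_norm _) xr.
    have [||c /andP[h1 h2] E] := @mean_value _ u (derive1 u) ar x axr.
    - by move=> z _; exact: du.
    - by move=> z _; exact: uc.
    apply: le_lt_trans uar; rewrite -subr_le0 E mulr_le0_ge0//.
      by apply: dr; lra.
    by rewrite subr_ge0 ltW.
  rewrite (ltr0_norm xn) in xl.
  have axl : x < al by have := ler_norm (- al); rewrite normrN; lra.
  have [||c /andP[h1 h2] E] := @mean_value _ u (derive1 u) x al axl.
  - by move=> z _; exact: du.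
  - by move=> z _; exact: uc.
  apply: le_lt_trans ual; rewrite -subr_ge0 E mulr_ge0//.
    by apply: dl; lra.
  by rewrite subr_ge0 ltW.
Qed.

End SolutionProfile.

(** * Existence of profiles *)

Section Existence.
Context {R : realType}.
Variables (p beta lam : R).
Hypotheses (p1 : 1 < p) (hD : Dp p (beta, lam)).
Local Notation q := (conj_exp p).
Local Notation theta := (vartheta p beta).
Local Notation pf := (pfun lam theta).
Local Notation vm := (vmax lam theta).
Implicit Types (x y z v e r s t : R).

Let lam0 : 0 < lam := lam_gt0 hD.
Let theta0 : 0 < theta := theta_gt0 p1 hD.
Let q0 : 0 < q := conj_exp_gt0 p1.
Let q1 : 1 < q := conj_exp_gt1 p1.
Let p0 : 0 < p := lt_trans ltr01 p1.
Let vm0 : 0 < vm := vmax_gt0 theta lam0.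

(** Off the top the flux is, up to sign, [kap^(p - 1) * pf(u)^(1/q)], and the power [-1/p] produced
    by the chain rule cancels against [u']. At the top [pf(u) = 0] and the chain rule fails;
    [is_derive_extend] takes over. *)
Lemma profile_ode (kap x0 : R) u x : 0 < kap -> profile p beta lam kap x0 u -> 0 < u x ->
  is_derive x 1 (pflux p u) (kap `^ p / q * dpfun p beta lam (u x)).
Proof.
move=> kap0 uP ux.
have uc y : {for y, continuous u} by exact: (profile_continuous uP).
pose g y := kap `^ p / q * dpfun p beta lam (u y).
have dgc y : 0 < u y -> {for y, continuous g}.
  move=> uy; apply: continuousZfun.
  apply: (@continuous_compfun _ (dpfun p beta lam) u) => //.
  apply: continuousMfun.
    apply: (@continuous_compfun _ (ell lam) (fun v => v `^ theta)).
      exact: is_derive_continuous (is_derive1_powR theta uy).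
    exact: is_derive_continuous (is_derive_ell lam (powR_gt0 theta uy)).
  by apply: continuousZfun; exact: is_derive_continuous (is_derive1_powR (theta - 1) uy).
have kp : kap `^ p = kap `^ (p - 1) * kap by rewrite mulrC mulr_powRB1// ltW.
have fluxE (d W : R) : 0 <= W -> d = kap * W `^ p^-1 ->
    `|d| `^ (p - 2) * d = kap `^ (p - 1) * W `^ q^-1.
  move=> W0 ->; have [->|Wn] := eqVneq W 0.
    by rewrite !powR0 ?invr_eq0 ?gt_eqF// !mulr0.
  have Wp : 0 < W by rewrite lt_neqAle eq_sym Wn.
  have d0 : 0 < kap * W `^ p^-1 by rewrite mulr_gt0// powR_gt0.
  rewrite gtr0_norm// mulrC -{1}[kap * _](powRr1 (ltW d0)) -powRD ?(gt_eqF d0) ?implybT//.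
  have -> : 1 + (p - 2) = p - 1 by ring.
  rewrite (powRM _ (ltW kap0) (powR_ge0 _ _)) -powRrM; congr (_ * _ `^ _).
  by rewrite (conj_expV p1); field; rewrite gt_eqF.
have away y : 0 < u y -> y != x0 -> is_derive y 1 (pflux p u) (g y).
  move=> uy yx.
  have uyv : u y < vm by exact: (profile_lt uP).
  have Wy : 0 < pf (u y) by exact: pfun_gt0.
  have dW := @is_derive_compfun _ (fun w => w `^ q^-1) pf (u y) _ _
    (is_derive1_powR q^-1 Wy) (is_derive_pfun theta lam0 uy).
  have W1 : pf (u y) `^ (q^-1 - 1) * pf (u y) `^ p^-1 = 1.
    rewrite -powRD ?(gt_eqF Wy) ?implybT//.
    by have -> : q^-1 - 1 + p^-1 = 0 by [rewrite (conj_expV p1); ring]; rewrite powRr0.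
  have pf0 z : 0 <= pf (u z) by apply: pfun_ge0 => //; exact: (profile_le uP).
  have dyx : 0 < `|y - x0| by rewrite normr_gt0 subr_eq0.
  have [yx0|yx0|] := ltgtP y x0; last by move=> yE; rewrite yE eqxx in yx.
    have du := profile_left uP (ltW yx0).
    have H := is_deriveZfun (kap `^ (p - 1)) (@is_derive_compfun _
      (fun v => pf v `^ q^-1) u y _ _ dW du).
    have E z : `|z - y| < `|y - x0| -> kap `^ (p - 1) * pf (u z) `^ q^-1 = pflux p u z.
      rewrite [X in _ < X]ltr0_norm ?subr_lt0// ltr_norml => /andP[_ h].
      have zx : z <= x0 by lra.
      rewrite /pflux (is_derive_derive1 (profile_left uP zx)).
      exact: esym (fluxE _ _ (pf0 z) erefl).
    apply: is_derive_eq (is_derive_ball dyx E H) _.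
    rewrite /g kp /dpfun -[RHS]mul1r -[X in _ = X * _]W1.
    by move: (pf (u y) `^ (q^-1 - 1)) (pf (u y) `^ p^-1) (kap `^ (p - 1)) (ell lam (u y `^ theta))
      (u y `^ (theta - 1)) => a b c d e; ring.
  have du := profile_right uP (ltW yx0).
  have H := is_deriveNfun (is_deriveZfun (kap `^ (p - 1)) (@is_derive_compfun _
    (fun v => pf v `^ q^-1) u y _ _ dW du)).
  have E z : `|z - y| < `|y - x0| -> - (kap `^ (p - 1) * pf (u z) `^ q^-1) = pflux p u z.
    rewrite [X in _ < X]gtr0_norm ?subr_gt0// ltr_norml => /andP[h _].
    have zx : x0 <= z by lra.
    rewrite /pflux (is_derive_derive1 (profile_right uP zx)) normrN mulrN.
    by rewrite (fluxE _ _ (pf0 z) erefl).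
  apply: is_derive_eq (is_derive_ball dyx E H) _.
  rewrite /g kp /dpfun -[RHS]mul1r -[X in _ = X * _]W1.
  by move: (pf (u y) `^ (q^-1 - 1)) (pf (u y) `^ p^-1) (kap `^ (p - 1)) (ell lam (u y `^ theta))
      (u y `^ (theta - 1)) => a b c d e; ring.
have [xx0|xx0] := eqVneq x x0; last exact: away.
rewrite xx0; rewrite xx0 in ux.
apply: (@is_derive_extend _ (pflux p u) g x0).
- have [d d0 H] := (continuous_epsP u x0).1 (uc x0) _ ux.
  apply/near_epsP; exists d => // y yd yx; apply: away => //.
  by have := H y yd; rewrite ltr_norml => /andP[h _]; lra.
- have d0 : derive1 u x0 = 0.
    rewrite (is_derive_derive1 (profile_left uP (lexx x0))) (profile_top uP) pfun_vmax//.
    by rewrite powR0 ?mulr0// invr_eq0 gt_eqF.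
  (* As [p - 2] may be negative, continuity of the flux at the top is drawn from the bound
     [|u'|^(p - 1)], whose exponent is positive. *)
  have nc : {for x0, continuous (fun y => `|derive1 u y| `^ (p - 1))}.
    apply: (@continuous_compfun _ (fun d => `|d| `^ (p - 1)) (derive1 u)).
      exact: (profile_C1 p1 hD uP).
    by apply: powR_norm_continuous; rewrite subr_gt0.
  apply/continuous_epsP => e e0; have [d d0' H] := (continuous_epsP _ _).1 nc e e0.
  have fx : pflux p u x0 = 0 by rewrite /pflux d0 mulr0.
  have nx : `|derive1 u x0| `^ (p - 1) = 0.
    have /eqP := d0; rewrite -normr_eq0 => /eqP ->.
    by rewrite powR0// gt_eqF// subr_gt0.
  exists d => // y yd; have := H y yd; rewrite /= fx nx !subr0 /pflux.
  apply: le_lt_trans; rewrite normrM.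
  rewrite [X in X * _](ger0_norm (powR_ge0 _ _)) [X in _ <= X](ger0_norm (powR_ge0 _ _)).
  have [dz|dn] := eqVneq (derive1 u y) 0.
    by rewrite dz normr0 mulr0 powR_ge0.
  have dn' : `|derive1 u y| != 0 by rewrite normr_eq0.
  rewrite -[X in _ * X](powRr1 (normr_ge0 _)) -powRD ?dn' ?implybT//.
  by have -> : p - 2 + 1 = p - 1 by ring.
- exact: dgc.
Qed.

(* The inverse of a profile is parametrized by [u = V s] rather than by [u]: the
   density of [x] in [s] is then continuous and positive, also at the top. *)
Let V s := vm / (1 + `|s| `^ q).

Let den_gt0 s : 0 < 1 + `|s| `^ q.
Proof. by rewrite ltr_pwDl// powR_ge0. Qed.

Let V_gt0 s : 0 < V s. Proof. exact: divr_gt0. Qed.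

Let V0 : V 0 = vm.
Proof. by rewrite /V normr0 powR0 ?gt_eqF// addr0 divr1. Qed.

Let V_decr s t : `|s| < `|t| -> V t < V s.
Proof.
move=> st; rewrite /V ltr_pM2l// ltf_pV2 ?posrE// ltrD2l.
by apply: gt0_ltr_powR; rewrite ?nnegrE.
Qed.

Let V_small e : 0 < e -> exists2 s, 0 < s & V s < e.
Proof.
move=> e0; have ve : 0 < vm / e by exact: divr_gt0.
exists ((vm / e) `^ q^-1); first exact: powR_gt0.
rewrite /V ger0_norm ?powR_ge0// -powRrM mulVf ?gt_eqF// (powRr1 (ltW ve)).
rewrite ltr_pdivrMr; last by rewrite addr_gt0.
by rewrite mulrDr mulr1 mulrCA mulfV ?mulr1 ?gt_eqF// ltrDr.
Qed.

Let dV s : is_derive s 1 V (- (vm * q * (`|s| `^ (q - 2) * s) / (1 + `|s| `^ q) ^+ 2)).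
Proof.
have dn := is_deriveDfun (is_derive_cstfun 1 s) (is_derive_powR_norm s q1).
have di := @is_derive_compfun _ (fun y => y `^ (-1)) (fun s => 1 + `|s| `^ q) s _ _
  (is_derive1_powR (-1) (den_gt0 s)) dn.
have -> : V = (fun s => vm * (1 + `|s| `^ q) `^ (-1)).
  by apply/funext => t; rewrite /V powR_inv1 ?(ltW (den_gt0 t)).
apply: is_derive_eq (is_deriveZfun vm di) _.
have -> : -1 - 1 = - 2%:R :> R by ring.
rewrite (powR_invn _ (ltW (den_gt0 s))); move: (1 + _) (den_gt0 s) => D D0.
by move: (`|s| `^ _) => a; field; rewrite gt_eqF.
Qed.

(* The difference quotient of [- pf] at [vm], where [pf] has a simple zero. *)
Let slope v := if v == vm then - dpfun p beta lam vm else pf v / (vm - v).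

Let slope_gt0 v : 0 < v -> v <= vm -> 0 < slope v.
Proof.
move=> v0 vv; rewrite /slope; case: eqVneq => [_|vn].
  rewrite /dpfun (vmaxE lam0 theta0) (ell_ymax lam0) mulN1r opprK.
  by apply: mulr_gt0 => //; exact: powR_gt0.
have vlt : v < vm by rewrite lt_neqAle vn.
by apply: divr_gt0; [exact: pfun_gt0|rewrite subr_gt0].
Qed.

Let slopeE v : slope v * (vm - v) = pf v.
Proof.
rewrite /slope; case: eqVneq => [->|vn]; first by rewrite subrr mulr0 pfun_vmax.
by rewrite divfK// subr_eq0 eq_sym.
Qed.

Let slope_continuous v : 0 < v -> {for v, continuous slope}.
Proof.
move=> v0; have [->|vn] := eqVneq v vm.
  have [g [gE gc gv]] := (is_derive1_caratheodory _ _ _).1 (is_derive_pfun theta lam0 vm0).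
  have -> : slope = (fun v => - g v).
    apply/funext => z; rewrite /slope; case: eqVneq => [->|zn]; first by rewrite gv.
    have zn' : z - vm != 0 by rewrite subr_eq0.
    have := gE z; rewrite pfun_vmax// subr0 => ->.
    by rewrite -[vm - z]opprB invrN mulrN mulfK.
  exact: continuousNfun.
have c1 : {for v, continuous (fun z => pf z / (vm - z))}.
  apply: continuousMfun; first exact: pfun_continuous.
  apply: (@continuous_compfun _ (fun z => z^-1) (fun z => vm - z)).
    have := is_deriveDfun (is_derive_cstfun vm v) (is_derive_oppfun v).
    exact: is_derive_continuous.
  by apply: inv_continuous; rewrite subr_eq0 eq_sym.
have dv0 : 0 < `|v - vm| by rewrite normr_gt0 subr_eq0.
apply/continuous_epsP => e e0; have [d d0 H] := (continuous_epsP _ _).1 c1 e e0.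
exists (Num.min d `|v - vm|); first by rewrite lt_min d0.
move=> z; rewrite lt_min => /andP[zd zv].
have zn : z != vm by apply: contraTneq zv => ->; rewrite distrC ltxx.
by rewrite /slope (negPf zn) (negPf vn); exact: H.
Qed.

Variable kap : R.
Hypothesis kap0 : 0 < kap.

(** What remains of [pf (V s)] after the factor [|s|^q], because [vm - V s = |s|^q * V s]; it is
    positive also at [s = 0]. The exponent [q] in [V] is chosen so that [pf(V s)^(1/p)] and the
    derivative of [V] vanish at the same order [q / p = q - 1], leaving a finite positive ratio
    [speed]. *)
Let rr s := slope (V s) * V s.

Let V_le s : V s <= vm.
Proof.
have [->|sn] := eqVneq s 0; first by rewrite V0.
by rewrite -V0 ltW// V_decr// normr0 normr_gt0.
Qed.

Let rr_gt0 s : 0 < rr s.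
Proof. by apply: mulr_gt0 => //; exact: slope_gt0. Qed.

Let rrE s : `|s| `^ q * rr s = pf (V s).
Proof.
rewrite -slopeE /rr mulrCA; congr (_ * _).
have D0 := den_gt0 s; rewrite /V; move: (`|s| `^ q) D0 => a D0.
by field; rewrite gt_eqF.
Qed.

(* [dx/ds] along the profile parametrized by [u = V s]. *)
Let speed s := vm * q / kap * ((1 + `|s| `^ q) `^ (- 2) * rr s `^ (- p^-1)).

Let speed_gt0 s : 0 < speed s.
Proof.
apply: mulr_gt0; first by apply: divr_gt0 => //; exact: mulr_gt0.
by apply: mulr_gt0; apply: powR_gt0.
Qed.

Let speed_continuous : continuous speed.
Proof.
have H s : {for s, continuous speed}.
  have dc : {for s, continuous (fun s => 1 + `|s| `^ q)}.
    by apply: continuousDfun; [exact: cst_continuous|exact: powR_norm_continuous].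
  have Vc : {for s, continuous V} by exact: is_derive_continuous (dV s).
  apply: continuousZfun; apply: continuousMfun.
    apply: (@continuous_compfun _ (fun y => y `^ (-2)) (fun s => 1 + `|s| `^ q)) => //.
    exact: is_derive_continuous (is_derive1_powR (-2) (den_gt0 s)).
  apply: (@continuous_compfun _ (fun y => y `^ (- p^-1)) rr).
    by apply: continuousMfun => //; apply: continuous_compfun => //; exact: slope_continuous.
  exact: is_derive_continuous (is_derive1_powR (- p^-1) (rr_gt0 s)).
exact: H.
Qed.

Let dV_speed s : - (vm * q * (`|s| `^ (q - 2) * s) / (1 + `|s| `^ q) ^+ 2) / speed s =
  - (kap * (`|s| `^ (q - 2) * s * rr s `^ p^-1)).
Proof.
have r0 := powR_gt0 p^-1 (rr_gt0 s).
rewrite /speed (powRN (rr s)) (powR_invn 2 (ltW (den_gt0 s))).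
move: (1 + _) (den_gt0 s) (rr s `^ _) r0 (`|s| `^ _) => D D0 r r0 a.
by field; rewrite !gt_eqF.
Qed.

Let powR_rr s : s != 0 -> `|s| `^ (q - 1) * rr s `^ p^-1 = pf (V s) `^ p^-1.
Proof.
move=> sn; have rs := ltW (rr_gt0 s).
rewrite -rrE (powRM _ (powR_ge0 _ _) rs) -powRrM; congr (_ `^ _ * _).
rewrite -[p^-1](subKr 1) -(conj_expV p1); field; exact: lt0r_neq0.
Qed.

Let dV_left s : s <= 0 ->
  - (kap * (`|s| `^ (q - 2) * s * rr s `^ p^-1)) = kap * pf (V s) `^ p^-1.
Proof.
rewrite le_eqVlt => /predU1P[->|s0].
  by rewrite mulr0 mul0r mulr0 oppr0 V0 pfun_vmax// powR0 ?mulr0// invr_eq0 gt_eqF.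
have sn : s != 0 by rewrite lt_eqF.
have nn : `|s| != 0 by rewrite normr_eq0.
rewrite -powR_rr// -mulrN -mulNr -mulrN; congr (_ * (_ * _)).
have -> : q - 1 = q - 2 + 1 by ring.
by rewrite [RHS]powRD ?nn ?implybT// [X in _ = _ * X](powRr1 (normr_ge0 _)) [X in _ = _ * X](ltr0_norm s0).
Qed.

Let dV_right s : 0 <= s ->
  - (kap * (`|s| `^ (q - 2) * s * rr s `^ p^-1)) = - (kap * pf (V s) `^ p^-1).
Proof.
rewrite le_eqVlt => /predU1P[<-|s0].
  by rewrite mulr0 mul0r mulr0 oppr0 V0 pfun_vmax// powR0 ?mulr0 ?oppr0// invr_eq0 gt_eqF.
have sn : s != 0 by rewrite gt_eqF.
have nn : `|s| != 0 by rewrite normr_eq0.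
rewrite -powR_rr//; congr (- (_ * (_ * _))).
have -> : q - 1 = q - 2 + 1 by ring.
by rewrite [RHS]powRD ?nn ?implybT// [X in _ = _ * X](powRr1 (normr_ge0 _)) [X in _ = _ * X](gtr0_norm s0).
Qed.

Section Inverse.
Variable X : R -> R.
Hypothesis dX : forall s, is_derive s 1 X (speed s).
Hypothesis X0 : X 0 = 0.

Let Xc s : {for s, continuous X}. Proof. exact: is_derive_continuous (dX s). Qed.

Let X_incr s t : s < t -> X s < X t.
Proof.
move=> st; have cc z : s <= z <= t -> {for z, continuous X} by move=> _; exact: Xc.
have [c _ E] := @mean_value _ X speed s t st (fun z _ => dX z) cc.
by rewrite -subr_gt0 E mulr_gt0// subr_gt0.
Qed.

Let X_lt s t : X s < X t -> s < t.
Proof.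
move=> XX; have [//|ts|st] := ltgtP s t; last by move: XX; rewrite st ltxx.
by have := lt_trans XX (X_incr ts); rewrite ltxx.
Qed.

Let X_between s t x : X s <= x -> x <= X t -> exists r, X r = x.
Proof.
move=> sx xt; have st : s <= t.
  by rewrite leNgt; apply/negP => /X_incr; lra.
have mm : Num.min (X s) (X t) <= x <= Num.max (X s) (X t) by rewrite ge_min le_max sx xt orbT.
by have [r _ rx] := IVT st (continuous_itvcc (fun x _ => @Xc x)) mm; exists r.
Qed.

Let Y x := xget 0 [set s | X s = x].

Let XK s : Y (X s) = s.
Proof.
rewrite /Y; case: xgetP => [t _ /= tE|/(_ s) []//].
have [ts|st|//] := ltgtP t s; first by have := X_incr ts; rewrite tE ltxx.
by have := X_incr st; rewrite tE ltxx.
Qed.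

(** The range of [X] is an open interval that may be bounded; outside it the profile has reached
    0. *)
Definition bell x := if `[< exists s, X s = x >] then V (Y x) else 0.

Lemma bellE s : bell (X s) = V s.
Proof.
by rewrite /bell; case: asboolP => [_|[]]; [rewrite XK|exists s].
Qed.

Lemma bell_out x : ~ (exists s, X s = x) -> bell x = 0.
Proof. by rewrite /bell; case: asboolP. Qed.

Let is_derive_bell s : is_derive (X s) 1 bell
  (- (kap * (`|s| `^ (q - 2) * s * rr s `^ p^-1))).
Proof.
have dY : is_derive (X s) 1 Y (speed s)^-1.
  apply: (@is_derive_inverse _ X Y) => //; last exact: lt0r_neq0.
  - by near=> t; exact: XK.
  - by near=> t; exact: Xc.
have dV' : is_derive (Y (X s)) 1 V
  (- (vm * q * (`|s| `^ (q - 2) * s) / (1 + `|s| `^ q) ^+ 2)) by rewrite XK; exact: dV.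
have H := is_derive_compfun dV' dY; rewrite dV_speed in H.
have a1 : X (s - 1) < X s by apply: X_incr; lra.
have a2 : X s < X (s + 1) by apply: X_incr; lra.
have d0 : 0 < Num.min (X s - X (s - 1)) (X (s + 1) - X s) by rewrite lt_min !subr_gt0 a1.
apply: (is_derive_ball d0 _ H) => y; rewrite lt_min !ltr_norml.
move=> /andP[/andP[h1 _] /andP[_ h2]].
have [||r <-] := @X_between (s - 1) (s + 1) y; [lra|lra|].
by rewrite bellE XK.
Unshelve. all: by end_near. Qed.

Lemma bell_above_lt s1 x : 0 <= s1 -> X s1 < x -> bell x < V s1.
Proof.
move=> s10 sx; have [[s sE]|/bell_out->//] := pselect (exists s, X s = x).
rewrite -sE bellE; apply: V_decr; rewrite -sE in sx.
by have := X_lt sx => ss; rewrite !ger0_norm//; lra.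
Qed.

Lemma bell_ge0 x : 0 <= bell x.
Proof.
have [[s <-]|/bell_out->//] := pselect (exists s, X s = x).
by rewrite bellE ltW.
Qed.

Lemma bell_below x : x <= 0 -> (exists s, X s = x) ->
  is_derive x 1 bell (kap * pf (bell x) `^ p^-1).
Proof.
move=> x0 [s sE]; rewrite -sE bellE -dV_left; first exact: is_derive_bell.
by rewrite leNgt; apply/negP => /X_incr; rewrite X0 sE; lra.
Qed.

Lemma bell_above x : 0 <= x -> (exists s, X s = x) ->
  is_derive x 1 bell (- (kap * pf (bell x) `^ p^-1)).
Proof.
move=> x0 [s sE]; rewrite -sE bellE -dV_right; first exact: is_derive_bell.
by rewrite leNgt; apply/negP => /X_incr; rewrite X0 sE; lra.
Qed.

Let bell_flat z x : (forall s, X s < z) -> z < x -> is_derive x 1 bell 0.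
Proof.
move=> Xz zx; have d0 : 0 < x - z by rewrite subr_gt0.
apply: (is_derive_ball d0 _ (is_derive_cstfun 0 x)) => y.
rewrite ltr_norml => /andP[h _]; rewrite bell_out// => -[s sE].
by have := Xz s; lra.
Qed.

(** Beyond the supremum of the range, [bell] is locally 0. At the supremum itself it is continuous,
    as [V] tends to 0, and on both sides its derivative is the continuous function [g], so
    [is_derive_extend] applies. *)
Lemma bell_end x : (forall s, X s < x) -> is_derive x 1 bell 0.
Proof.
move=> Xx; have [[z zx Xz]|nz] := pselect (exists2 z, z < x & forall s, X s < z).
  exact: bell_flat zx.
pose g y := - (kap * (Num.max (pf (bell y)) 0) `^ p^-1).
have x_out : ~ (exists s, X s = x) by move=> [s sE]; have := Xx s; rewrite sE ltxx.
have bx : bell x = 0 by exact: bell_out.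
have g0 y : bell y = 0 -> g y = 0.
  move=> bey; rewrite /g bey pfun_le0// maxxx powR0 ?mulr0 ?oppr0// invr_eq0.
  exact: lt0r_neq0.
have bc : {for x, continuous bell}.
  apply/continuous_epsP => e e0; have [s s0 Vs] := V_small e0.
  exists (x - X s); first by rewrite subr_gt0.
  move=> y; rewrite ltr_norml => /andP[h _]; rewrite bx subr0 ger0_norm ?bell_ge0//.
  by apply: lt_trans Vs; apply: bell_above_lt; [exact: ltW|lra].
rewrite -(g0 x bx); apply: is_derive_extend => //.
  (* The radius [x] keeps [y] positive, on the decreasing side where the sign in [g] is the right
     one. *)
  apply/near_epsP; exists x; first by have := Xx 0; rewrite X0.
  move=> y; rewrite ltr_norml => /andP[h _] yx.
  have y0 : 0 < y by lra.
  have [yx'|xy|yE] := ltgtP y x; last by rewrite yE eqxx in yx.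
    have [t ty] : exists t, y <= X t.
      apply: contrapT => nt; apply: nz; exists y => // s.
      by rewrite ltNge; apply/negP => ys; apply: nt; exists s.
    have yin : exists s, X s = y by apply: (@X_between 0 t); rewrite ?X0 ?(ltW y0).
    apply: is_derive_eq (bell_above (ltW y0) yin) _; rewrite /g (max_idPl _)//.
    case: yin => s <-; rewrite bellE; apply: pfun_ge0 => //; exact: V_le.
  apply: is_derive_eq (bell_flat Xx xy) _.
  have y_out : ~ (exists s, X s = y) by move=> [s sE]; have := Xx s; rewrite sE; lra.
  exact: esym (g0 y (bell_out y_out)).
apply: continuousNfun; apply: continuousZfun.
apply: (@continuous_compfun _ (fun w => (Num.max w 0) `^ p^-1) (fun y => pf (bell y))).
  by apply: continuous_compfun => //; exact: pfun_continuous.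
by apply: powR_max0_continuous; rewrite invr_gt0.
Qed.

Lemma bell_outside x : ~ (exists s, X s = x) -> (forall s, X s < x) \/ (forall s, x < X s).
Proof.
move=> nx; have [[s xs]|ns] := pselect (exists s, x <= X s); last first.
  by left => s; rewrite ltNge; apply/negP => xs; apply: ns; exists s.
right => t; rewrite ltNge; apply/negP => tx; apply: nx; exact: X_between tx xs.
Qed.

Lemma bell_interval : is_interval (posset bell).
Proof.
have pos_in x : 0 < bell x -> exists s, X s = x.
  by move=> bx; apply: contrapT => /bell_out bx0; move: bx; rewrite bx0 ltxx.
move=> x y /pos_in[s sx] /pos_in[t ty] z /andP[xz zy].
have [||r <-] := @X_between s t z; rewrite ?sx ?ty//.
by rewrite /posset /= bellE.
Qed.

Lemma bell_top : bell 0 = vm. Proof. by rewrite -X0 bellE V0. Qed.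

Lemma bell_lt x : x != 0 -> bell x < vm.
Proof.
move=> xn; have [[s sE]|/bell_out->//] := pselect (exists s, X s = x).
rewrite -sE bellE -V0; apply: V_decr; rewrite normr0 normr_gt0.
by apply: contra xn => /eqP s0; rewrite -sE s0 X0.
Qed.

End Inverse.

(** [speed] and [V] are even. The lower end of the support is thereby reduced to the upper end of a
    reflected bell. *)
Lemma bell_opp (X : R -> R) : (forall s, is_derive s 1 X (speed s)) -> X 0 = 0 ->
  [/\ forall s, is_derive s 1 (fun s => - X (- s)) (speed s),
      - X (- 0) = 0 & forall x, bell (fun s => - X (- s)) x = bell X (- x)].
Proof.
move=> dX X0.
have dX' s : is_derive s 1 (fun s => - X (- s)) (speed s).
  have H := is_deriveNfun (@is_derive_compfun _ X -%R s _ _ (dX (- s)) (is_derive_oppfun s)).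
  apply: is_derive_eq H _; rewrite mulrN1 opprK /speed /rr /V normrN.
  by [].
split => //; first by rewrite oppr0 X0 oppr0.
move=> x; have [[s sE]|nx] := pselect (exists s, X s = - x).
  have xE : x = - X (- (- s)) by rewrite opprK sE opprK.
  rewrite -sE (bellE dX) {1}xE (@bellE (fun s => - X (- s)) dX').
  by rewrite /V normrN.
rewrite (bell_out nx) bell_out// => -[s sE]; apply: nx; exists (- s).
by rewrite -sE opprK.
Qed.

Lemma profile_exists : exists u, profile p beta lam kap 0 u /\ is_interval (posset u).
Proof.
have [X1 dX1] := antiderivative speed_continuous.
pose X s := X1 s + - X1 0.
have dX s : is_derive s 1 X (speed s).
  by apply: is_derive_eq (is_deriveDfun (dX1 s) (is_derive_cstfun (- X1 0) s)) _; rewrite addr0.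
have X0 : X 0 = 0 by rewrite /X subrr.
have [dX' X0' opp] := bell_opp dX X0.
exists (bell X); split; last exact: bell_interval.
have off x : ~ (exists s, X s = x) -> is_derive x 1 (bell X) 0.
  move=> nx; have [xu|xl] := bell_outside dX nx; first exact: bell_end dX X0 _ xu.
  have H : is_derive (- x) 1 (bell (fun s => - X (- s))) 0.
    by apply: bell_end => // s; rewrite ltrN2.
  have H' := @is_derive_compfun _ (bell (fun s => - X (- s))) -%R x _ _ H (is_derive_oppfun x).
  have bE : (fun y => bell (fun s => - X (- s)) (- y)) = bell X.
    by apply/funext => y; rewrite opp opprK.
  by rewrite bE in H'; apply: is_derive_eq H' _; rewrite mul0r.
have off0 x : ~ (exists s, X s = x) -> kap * pf (bell X x) `^ p^-1 = 0.
  by move=> nx; rewrite bell_out// pfun_le0// powR0 ?mulr0// invr_eq0 gt_eqF.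
split.
- exact: bell_ge0.
- exact: bell_top.
- exact: bell_lt.
- move=> x x0; have [xin|nx] := pselect (exists s, X s = x); first exact: bell_below.
  by apply: is_derive_eq (off x nx) _; rewrite off0.
- move=> x x0; have [xin|nx] := pselect (exists s, X s = x); first exact: bell_above.
  by apply: is_derive_eq (off x nx) _; rewrite off0// oppr0.
- move=> e e0; have [s s0 Vs] := V_small e0.
  exists (Num.max `|X s| `|- X (- s)|) => x; rewrite gt_max => /andP[h1 h2].
  apply: lt_trans Vs; have [xp|xn] := leP 0 x.
    apply: (bell_above_lt dX (ltW s0)); rewrite (ger0_norm xp) in h1.
    exact: le_lt_trans (ler_norm _) h1.
  have -> : bell X x = bell (fun s => - X (- s)) (- x) by rewrite opp opprK.
  apply: (bell_above_lt dX' (ltW s0)); rewrite (ltr0_norm xn) in h2.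
  exact: le_lt_trans (ler_norm _) h2.
Qed.

End Existence.

(** * Normalization of the mass, and the theorem *)

Section Main.
Context {R : realType}.
Variables (p beta lam : R).
Hypotheses (p1 : 1 < p) (hD : Dp p (beta, lam)).
Local Notation leb := (@lebesgue_measure R).
Local Notation q := (conj_exp p).
Local Notation theta := (vartheta p beta).
Local Notation k := (q / theta).

Let lam0 : 0 < lam := lam_gt0 hD.
Let theta0 : 0 < theta := theta_gt0 p1 hD.
Let q0 : 0 < q := conj_exp_gt0 p1.
Let k0 : 0 < k := divr_gt0 q0 theta0.
Local Notation J := (Jphi lam0 p1 theta0).

Let J0 : 0 < J := Jphi_gt0 lam0 p1 theta0.

Lemma profile_density (kap x0 : R) u (mu : R) : 0 < kap -> profile p beta lam kap x0 u -> 0 < mu ->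
  mu * (2 * ((lam + k) * J / kap)) = 1 -> is_density (fun x => mu * u x `^ theta).
Proof.
move=> kap0 uP mu0 mE.
have u0 (x : R) : 0 <= u x `^ theta by exact: powR_ge0.
have mu_theta : measurable_fun [set: R] (fun x => u x `^ theta).
  apply: continuous_measurable_fun.
  have H (x : R) : {for x, continuous (fun x => u x `^ theta)}.
    have -> : (fun x => u x `^ theta) = (fun x => (Num.max (u x) 0) `^ theta).
      by apply/funext => y; rewrite (max_idPl (profile_ge0 uP y)).
    apply: (@continuous_compfun _ (fun y => (Num.max y 0) `^ theta) u).
      exact: (profile_continuous uP).
    exact: powR_max0_continuous.
  exact: H.
split.
- by move=> x; apply: mulr_ge0 => //; exact: ltW.
- by apply: measurable_funM => //; exact: measurable_cst.
- under eq_integral do rewrite EFinM.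
  rewrite ge0_integralZl_EFin//; last 3 first.
  + by move=> x _; rewrite lee_fin.
  + exact/measurable_EFinP.
  + exact: ltW.
  by rewrite (profile_mass p1 hD kap0 uP) -EFinM mE.
Qed.

Lemma solution_exists : exists (gam : R) (u : R -> R),
  is_solution p beta lam gam u /\ is_density (fun x => u x `^ theta).
Proof.
(* The value for which [profile_mass] gives mass 1. *)
pose kap := 2 * ((lam + k) * J).
have m0 : 0 < (lam + k) * J by apply: mulr_gt0 => //; exact: addr_gt0.
have kap0 : 0 < kap by exact: mulr_gt0.
have [u [uP ui]] := profile_exists p1 hD kap0.
(* [gam] is found by equating the factor [gam / theta^2] of [reactionE] with the factor [kap^p / q]
   of [profile_ode]. *)
exists (theta ^+ 2 * (kap `^ p / q)), u; split; last first.
  have := profile_density kap0 uP ltr01; rewrite mul1r mulrA divff ?gt_eqF// => /(_ erefl).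
  by have -> : (fun x => 1 * u x `^ theta) = (fun x => u x `^ theta)
    by apply/funext => x; rewrite mul1r.
split.
- exact: profile_ge0 uP.
- by move=> x; exact: (profile_derivable uP).
- exact: (profile_C1 p1 hD uP).
- exact: ui.
move=> x ux; have dx := profile_ode p1 hD kap0 uP ux.
split; first by have [] := dx.
rewrite (is_derive_derive1 dx) (reactionE p1 hD _ ux).
move: (dpfun _ _ _ _) (kap `^ p / q) => b c.
have t0 : theta != 0 by rewrite gt_eqF.
by field.
Qed.

(** The rescaled density is [mu * v^theta] with [mu = 1 / sigma] and [v] a profile of constant
    [kap / sigma]. The value in [profile_complexity] involves neither, so the invariance of the
    complexity needs no separate argument. *)
Lemma solution_attains (gam : R) u : is_solution p beta lam gam u ->
  is_density (fun x => u x `^ theta) -> forall x0 sigma : R, 0 < sigma ->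
  let rho := shift_scale x0 sigma (fun x => u x `^ theta) in
  admissible p beta lam rho /\
  complexity p beta lam rho = (2 * theta * J / peak lam k `^ q^-1) ^+ 2.
Proof.
move=> uS uD x1 sigma s0; have [kap [x0 [kap0 uP]]] := solution_profile p1 hD uS uD.
have vP := profile_affine x1 s0 uP.
have ks0 : 0 < kap / sigma by exact: divr_gt0.
have si0 : 0 < sigma^-1 by rewrite invr_gt0.
have mE : 2 * ((lam + k) * J / kap) = 1.
  by case: uD => _ _; rewrite (profile_mass p1 hD kap0 uP) => -[].
have vD : is_density (fun x => sigma^-1 * u ((x - x1) / sigma) `^ theta).
  apply: (profile_density ks0 vP si0); rewrite -[RHS]mE.
  move: (_ * J) => m; have sn : sigma != 0 by rewrite gt_eqF.
  have kn : kap != 0 by rewrite gt_eqF.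
  by field; rewrite kn.
split; first exact: (profile_admissible p1 hD ks0 vP si0 vD).
exact: (profile_complexity p1 hD ks0 vP si0 vD).
Qed.

End Main.

Theorem proposition2 (R : realType) (p beta lam : R)
    (hp : 1 < p) (hD : Dp p (beta, lam)) :
  (exists K : R,
    [/\ 0 < K,
        (forall rho : R -> R, admissible p beta lam rho ->
           K <= complexity p beta lam rho),
        (forall K' : R,
           (forall rho : R -> R, admissible p beta lam rho ->
              K' <= complexity p beta lam rho) -> K' <= K),
        (exists (gam : R) (u : R -> R),
           is_solution p beta lam gam u /\
           is_density (fun x => u x `^ vartheta p beta)) &
        (forall (gam : R) (u : R -> R),
           is_solution p beta lam gam u ->
           is_density (fun x => u x `^ vartheta p beta) ->
           forall x0 sigma : R, 0 < sigma ->
           let rho := shift_scale x0 sigma (fun x => u x `^ vartheta p beta) in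
           admissible p beta lam rho /\ complexity p beta lam rho = K)]) /\
  (forall gam v : R, 0 < v ->
     reaction_neq1 (vartheta p beta) gam l v @[l --> (1 : R)^'] -->
       reaction_eq1 (vartheta p beta) gam v).
Proof.
have lam0 := lam_gt0 hD; have theta0 := theta_gt0 hp hD.
split; last by move=> gam v v0; apply: reaction_limit => //; rewrite gt_eqF.
exists ((2 * vartheta p beta * Jphi (lam_gt0 hD) hp (theta_gt0 hp hD) /
  peak lam (conj_exp p / vartheta p beta) `^ (conj_exp p)^-1) ^+ 2); split.
- apply: exprn_gt0; apply: divr_gt0; last first.
    by apply: powR_gt0; apply: peak_gt0 => //; apply: divr_gt0 => //; exact: conj_exp_gt0.
  by apply: mulr_gt0; [exact: mulr_gt0|exact: Jphi_gt0].
- by move=> rho rhoA; exact: (le_complexity hp hD rhoA).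
(* A lower bound cannot exceed a value that is attained; the existing solution, unshifted and
   unscaled, attains [K]. *)
- move=> K' lbK; have [gam [u [uS uD]]] := solution_exists hp hD.
  have [rA <-] := solution_attains hp hD uS uD 0 ltr01.
  exact: lbK.
- exact: solution_exists.
- by move=> gam u uS uD x0 sigma s0; exact: (solution_attains hp hD uS uD x0 s0).
Qed.
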